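(* Let $d\ge2$ and $k,m\ge1$ be integers and let $a_i$ be the number of Lyndon words of length $i$ in the alphabet $\{1,\dots,d\}$. The (a priori rational) map $\mathbb{P}(1^{a_1},\dots,m^{a_m})\to\mathbb{P}^N$ given by all monomials of weighted degree $k$ is an embedding if and only if $i\mid k$ for every $i\in\{1,\dots,m\}$. If so, the rough Veronese variety $\mathcal{R}_{d,k,m}\simeq\mathbb{P}(1^{a_1},\dots,m^{a_m})$ is embedded as a projectively normal variety.
   Context: $\mathbb{P}(1^{a_1},\dots,m^{a_m})$ is the weighted projective space over $\mathbb{C}$ with $a_i$ variables of weight $i$ for each $i=1,\dots,m$, and $N+1$ is the number of monomials of weighted degree $k$ in these variables. ''Embedding'' means a morphism defined everywhere that is a closed immersion. A projective variety is projectively normal if the affine cone over it is normal. A non-empty word $w$ is Lyndon if whenever $w=pq$ with $p,q$ nonempty words, $w<q$ in lexicographic order. Let $T((\mathbb{R}^d))=\prod_{k\ge 0}(\mathbb{R}^d)^{\otimes k}$ be the algebra of formal power series in non-commuting variables $x_1,\dots,x_d$, and let $p_k:T((\mathbb{R}^d))\to(\mathbb{R}^d)^{\otimes k}$ be the projection. Let $\mathrm{Lie}(\mathbb{R}^d)$ be the smallest vector subspace containing $x_1,\dots,x_d$ and closed under $[T,S]=TS-ST$, and let $\mathrm{Lie}^m(\mathbb{R}^d)$ be its truncation to tensor orders at most $m$ (regarded inside $T((\mathbb{R}^d))$). Put $\exp(L)=\sum_{n\ge0}L^{\otimes n}/n!$. The rough Veronese variety $\mathcal{R}_{d,k,m}\subset\mathbb{P}^{d^k-1}$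 is the Zariski closure of the image of $\mathrm{Lie}^m(\mathbb{R}^d)\xrightarrow{\exp}T((\mathbb{R}^d))\xrightarrow{p_k}(\mathbb{R}^d)^{\otimes k}\to(\mathbb{C}^d)^{\otimes k}\dashrightarrow\mathbb{P}^{d^k-1}$. It is known that, after a linear change of coordinates in which $\mathbb{P}^N$ is a linear subspace of $\mathbb{P}^{d^k-1}$, $\mathcal{R}_{d,k,m}$ is the closure of the image of the rational map $\mathbb{P}(1^{a_1},\dots,m^{a_m})\dashrightarrow\mathbb{P}^N$ given by all monomials of weighted degree $k$. *)

(* Defs.v *)
From HB Require Import structures.
From mathcomp Require Import all_boot all_order all_algebra.
From mathcomp Require Import generic_quotient complex mpoly.
From mathcomp Require Import boolp classical_sets reals.

Set Implicit Arguments.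
Unset Strict Implicit.
Unset Printing Implicit Defensive.

Import GRing.Theory.
Local Open Scope quotient_scope.
Local Open Scope classical_set_scope.
Local Open Scope ring_scope.

(* Varieties are classical ones: sets of closed points over an algebraically
   closed field K, carrying the Zariski topology and the sheaf of K-valued
   regular functions. *)

Section WeightedProjectiveSpace.
Variables (K : fieldType) (n : nat) (w : 'I_n -> nat).

Definition wcone := {v : 'rV[K]_n | v != 0}.

Definition wscaled (u v : 'rV[K]_n) : Prop :=
  exists2 t : K, t != 0 & forall i, v 0 i = t ^+ w i * u 0 i.

Definition wequiv (u v : wcone) : bool := `[< wscaled (val u) (val v) >].

Lemma wequiv_refl : reflexive wequiv.
Proof.
move=> u; apply/asboolP; exists 1; first exact: oner_neq0.
by move=> i; rewrite expr1n mul1r.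
Qed.

Lemma wequiv_sym : ssrbool.symmetric wequiv.
Proof.
suff H u v : wequiv u v -> wequiv v u by move=> u v; apply/idP/idP; apply: H.
move=> /asboolP[t t0 E]; apply/asboolP; exists t^-1; first by rewrite invr_eq0.
by move=> i; rewrite E exprVn mulKf // expf_neq0.
Qed.

Lemma wequiv_trans : transitive wequiv.
Proof.
move=> v u x /asboolP[s s0 Es] /asboolP[t t0 Et]; apply/asboolP.
exists (t * s); first by rewrite mulf_neq0.
by move=> i; rewrite Et Es exprMn mulrA.
Qed.

Canonical wequiv_equiv := EquivRel wequiv wequiv_refl wequiv_sym wequiv_trans.

(* K^n \ 0 modulo the action t . (v_i)_i = (t ^ (w_i) v_i)_i of K^*. *)
Definition wproj := {eq_quot wequiv}.

Definition wpoint (v : 'rV[K]_n) (hv : v != 0) : wproj :=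
  \pi_{eq_quot wequiv} (exist _ v hv).

(* A choice of homogeneous coordinates; it is only used in expressions which
   do not depend on the choice. *)
Definition hcoord (x : wproj) : 'rV[K]_n := val (repr x).

Definition wdeg (m : 'X_{1..n}) : nat := (\sum_(i < n) w i * m i)%N.

Lemma wdeg0 : wdeg 0%MM = 0%N.
Proof. by rewrite /wdeg big1 // => i _; rewrite mnm0E muln0. Qed.

Lemma wdegD : {morph wdeg : m1 m2 / (m1 + m2)%MM >-> (m1 + m2)%N}.
Proof.
move=> m1 m2; rewrite /wdeg -big_split /=.
by apply: eq_bigr => i _; rewrite mnmDE mulnDr.
Qed.

HB.instance Definition _ := isMeasure.Build n wdeg wdeg0 wdegD.

Definition zariski_closed (A : set wproj) : Prop :=
  exists S : set {mpoly K[n]},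
    (forall p, S p -> exists D, p \is ishomog1 D wdeg) /\
    A = [set x | forall p, S p -> p.@[hcoord x 0] = 0].

Definition zariski_open (A : set wproj) : Prop := zariski_closed (~` A).

Definition zariski_closure (A : set wproj) : set wproj :=
  \bigcap_(B in [set B | zariski_closed B /\ A `<=` B]) B.

(* f is regular on the locally closed subset U; its values outside U are
   irrelevant. *)
Definition regular_on (U : set wproj) (f : wproj -> K) : Prop :=
  forall x, U x -> exists V : set wproj, [/\ zariski_open V, V x &
    exists (D : nat) (g h : {mpoly K[n]}),
      [/\ g \is ishomog1 D wdeg, h \is ishomog1 D wdeg &
        forall y, V y -> U y ->
          h.@[hcoord y 0] != 0 /\ f y = g.@[hcoord y 0] / h.@[hcoord y 0]]].

Definition affine_cone (X : set wproj) : set 'rV[K]_n :=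
  [set v | forall hv : v != 0, X (wpoint hv)].

End WeightedProjectiveSpace.

Section Morphisms.
Variables (K : fieldType) (n1 n2 : nat) (w1 : 'I_n1 -> nat) (w2 : 'I_n2 -> nat).
Implicit Types (X : set (wproj K w1)) (Y : set (wproj K w2)).

(* X and Y are closed subvarieties; the values of phi outside X are
   irrelevant. *)
Definition is_morphism X Y (phi : wproj K w1 -> wproj K w2) : Prop :=
  [/\ forall x, X x -> Y (phi x),
      forall B, zariski_closed B ->
        exists2 A, zariski_closed A & X `&` phi @^-1` B = X `&` A &
      forall V f, zariski_open V -> regular_on (Y `&` V) f ->
        regular_on (X `&` phi @^-1` V) (f \o phi)].

End Morphisms.

Section Embeddings.
Variables (K : fieldType) (n1 n2 : nat) (w1 : 'I_n1 -> nat) (w2 : 'I_n2 -> nat).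
Implicit Types (X : set (wproj K w1)) (Y : set (wproj K w2)).

Definition is_isomorphism X Y (phi : wproj K w1 -> wproj K w2) : Prop :=
  is_morphism X Y phi /\
  exists psi : wproj K w2 -> wproj K w1,
    [/\ is_morphism Y X psi, forall x, X x -> psi (phi x) = x &
        forall y, Y y -> phi (psi y) = y].

Definition isomorphic X Y : Prop := exists phi, is_isomorphism X Y phi.

Definition closed_immersion X (phi : wproj K w1 -> wproj K w2) : Prop :=
  zariski_closed (phi @` X) /\ is_isomorphism X (phi @` X) phi.

(* F is a non-zero vector of weighted homogeneous polynomial functions of the
   same degree; it defines a rational map [x] |-> [F x] where F x != 0, and
   this map is an embedding when it extends to a closed immersion defined on
   the whole space. *)
Definition rational_map_embedding (F : 'rV[K]_n1 -> 'rV[K]_n2) : Prop :=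
  exists phi : wproj K w1 -> wproj K w2,
    (forall x (hx : F (hcoord x) != 0), phi x = wpoint w2 hx) /\
    closed_immersion [set: wproj K w1] phi.

End Embeddings.

Definition std_weight n : 'I_n -> nat := fun=> 1%N.

Definition integrally_closed (D : idomainType) : Prop :=
  forall z : {fraction D}, integralOver (@FracField.tofrac D) z ->
    exists y : D, z = FracField.tofrac y.

(* The coordinate ring of Z is presented as a surjective image D of the
   polynomial ring whose kernel is the ideal of Z. *)
Definition normal_affine_variety (K : fieldType) n (Z : set 'rV[K]_n) : Prop :=
  exists (D : idomainType) (f : {rmorphism {mpoly K[n]} -> D}),
    [/\ forall y, exists p, f p = y,
        forall p, f p = 0 <-> (forall v, Z v -> p.@[v 0] = 0) &
        integrally_closed D].

Definition projectively_normal (K : fieldType) n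
    (X : set (wproj K (@std_weight n))) : Prop :=
  normal_affine_variety (affine_cone X).

(* When all weights are positive, a monomial of weighted degree k has degree at
   most k, so these are all the monomials of weighted degree k. *)
Definition wmonomial n (w : 'I_n -> nat) (k : nat) :=
  {m : 'X_{1..n < k.+1} | wdeg w m == k}.

Definition wmonomial_map (K : fieldType) n (w : 'I_n -> nat) (k : nat)
    (v : 'rV[K]_n) : 'rV[K]_#|{: wmonomial w k}| :=
  \row_(j < #|{: wmonomial w k}|) ('X_[K, val (enum_val j)]).@[v 0].

Definition lyndon d (u : seq 'I_d) : bool :=
  (u != [::]) &&
  [forall j : 'I_(size u),
     (0 < j)%N ==> ((u : seqlexi 'I_d) < (drop j u : seqlexi 'I_d))%O].

Definition num_lyndon (d i : nat) : nat :=
  #|[pred u : i.-tuple 'I_d | lyndon u]|.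

(* 1, ..., 1, ..., m, ..., m with each i repeated num_lyndon d i times *)
Definition lyndon_weights (d m : nat) : seq nat :=
  flatten [seq nseq (num_lyndon d i) i | i <- iota 1 m].

Definition lyndon_weight (d m : nat) : 'I_(size (lyndon_weights d m)) -> nat :=
  tnth (in_tuple (lyndon_weights d m)).
Arguments lyndon_weight : clear implicits.

Section TensorSeries.
Variables (R : fieldType) (d : nat).

(* A non-commutative formal power series in x_0, ..., x_(d-1) is the family of
   its coefficients on words; its component of order k is its restriction to
   the words of length k. *)
Definition tseries := seq 'I_d -> R.

Definition tone : tseries := fun u => (u == [::])%:R.
Definition tvar (i : 'I_d) : tseries := fun u => (u == [:: i])%:R.
Definition tmul (S T : tseries) : tseries :=
  fun u => \sum_(j < (size u).+1) S (take j u) * T (drop j u).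
Definition tbracket (S T : tseries) : tseries :=
  fun u => tmul S T u - tmul T S u.

Definition tsubspace (V : set tseries) : Prop :=
  V (fun=> 0) /\
  forall a S T, V S -> V T -> V (fun u => a * S u + T u).

Definition lie_series : set tseries :=
  \bigcap_(V in [set V : set tseries |
      [/\ tsubspace V, forall i, V (tvar i) &
          forall S T, V S -> V T -> V (tbracket S T)]]) V.

Definition ttruncate (m : nat) (S : tseries) : tseries :=
  fun u => if (size u <= m)%N then S u else 0.

Definition lie_truncated (m : nat) : set tseries := ttruncate m @` lie_series.

Definition texpn (L : tseries) (j : nat) : tseries := iter j (tmul L) tone.

(* For L without constant term (in particular for Lie series), L^j vanishes on
   the words of length < j, so the sum over all j stops at the length of u. *)
Definition texp (L : tseries) : tseries :=
  fun u => \sum_(j < (size u).+1) texpn L j u / (j`!)%:R.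

End TensorSeries.

Local Open Scope complex_scope.

(* The coordinates of P^(d^k - 1) are indexed by the words of length k. *)
Definition tensor_component (R : realType) d k (S : tseries R d) :
    'rV[R[i]]_#|{: k.-tuple 'I_d}| :=
  \row_(j < #|{: k.-tuple 'I_d}|) (S (enum_val j))%:C.

Definition rough_veronese (R : realType) (d k m : nat) :
    set (wproj R[i] (@std_weight #|{: k.-tuple 'I_d}|)) :=
  zariski_closure
    [set x | exists L, lie_truncated m L /\
       exists hv : tensor_component k (texp L) != 0, x = wpoint _ hv].
Arguments rough_veronese : clear implicits.

(* Main.v *)
Require Import Defs.
From HB Require Import structures.
From mathcomp Require Import all_boot all_order all_algebra.
From mathcomp Require Import zify ring.
From mathcomp Require Import generic_quotient complex mpoly.
From mathcomp Require Import boolp classical_sets reals.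

(** Write S for the polynomial ring of the weighted projective space, graded by
    the weights, and S_k for its forms of weighted degree k.

    If a weight i does not divide k, let e be the point whose only non-zero
    coordinate is one of weight i.  Every monomial of degree k contains some
    other variable.  Two variables of weight 1 are available, so for each such
    monomial the lines joining e to the coordinate points of weight 1 include
    one along which the monomial vanishes and the map is defined away from e.  A
    continuous extension to e would then have all its coordinates equal to 0
    ([no_embedding]).

    If all i <= m divide k, the heart of the matter is combinatorial: every
    monomial of degree jk is a product of j monomials of degree k
    ([sub_packing], [monomial_packing]).  Hence, for any finite system of forms
    G_j spanning S_k, each form of degree kD on the source is the pull-back of a
    form of degree D on the target ([lift_homog]).  From this,
    - the map is closed: a point of the target where all relations between the
      G_j hold is a multiplicative function on the monomials whose degree is a
      multiple of k, and such a function is the evaluation at an actual point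
      because K^* is divisible ([toric_point], [system_proj_closed]);
    - it is injective ([toric_point_uniq]), and the inverse is regular since
      g / h = g h^(k-1) / h^k has numerator and denominator of degree a multiple
      of k ([system_inv_regular]);
    - the coordinate ring of the affine cone over the image is the Veronese ring,
      the sum of the S_jk ([system_image_projectively_normal]).  It is integrally
      closed, because S is ([mpoly_dvd_of_integral]) and a quotient of two
      elements of the Veronese ring that lies in S lies in the Veronese ring
      ([veronese_divides]).

    It remains to see that the rough Veronese variety is the image of such a
    system.  Lie series are primitive (they vanish on shuffle products), so
    exponentials of Lie series are group-like: a product of two coefficients of
    exp L is a sum of coefficients of exp L ([texp_grouplike]).  Therefore the
    coefficients of exp L on the words of length k span a graded algebra; it
    contains the coefficients of L itself ([coef_span_log]), which are thus
    recovered from exp L without any appeal to the Poincare-Birkhoff-Witt theorem.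
    The coefficients of L on the Lyndon words of length at most m are linear
    coordinates on the truncated Lie algebra ([lie_truncated_coordinates]):
    bracketing a Lyndon word along a factorization gives a Lie polynomial with
    that word as its smallest word, and among the words of a given length, the
    smallest one where a primitive series is not zero is Lyndon, since a word w
    that is not Lyndon splits as w = uv where w is the largest shuffle of u and v
    ([nonlyndon_factor]).  So the coefficients
    of exp L on words of length k are forms of weighted degree k which span S_k.
    Since real points are Zariski dense, the closure of the real image is the
    whole image ([rough_veronese_isomorphic_normal]). *)

Set Implicit Arguments.
Unset Strict Implicit.
Unset Printing Implicit Defensive.

Import Order.TTheory GRing.Theory Num.Theory.
Local Open Scope quotient_scope.
Local Open Scope classical_set_scope.
Local Open Scope ring_scope.

(** * Splitting a total that is a multiple of all weights *)

(** For m >= 3, the consecutive factors m and m-1 are coprime and gcd(m(m-1), m-2)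
    divides 2, so the product of the three divides 2k.  A cubic lower bound is what
    [frequent_weight] requires. *)
Lemma leq_lcm_range m k : (1 < m)%N -> (0 < k)%N ->
    (forall i, (1 <= i <= m)%N -> (i %| k)%N) ->
  (m * m.-1 * (m - 2) <= 2 * k)%N.
Proof.
case: m => [|[|[|m]]] // _ k0 dvd.
rewrite (_ : m.+3 - 2 = m.+1)%N ?subSS ?subn0 //=.
apply: dvdn_leq; first by rewrite muln_gt0.
have c1 : coprime m.+3 m.+2 by rewrite coprimeSn.
have c2 : coprime m.+2 m.+1 by rewrite coprimeSn.
have d1 : (m.+3 * m.+2 %| k)%N by rewrite Gauss_dvd // !dvd //=; lia.
have d2 : (m.+1 %| k)%N by apply: dvd; lia.
have g : (gcdn (m.+3 * m.+2) m.+1 %| 2)%N.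
  rewrite gcdnC Gauss_gcdl; last by rewrite coprime_sym.
  have := dvdn_sub (dvdn_gcdr m.+1 m.+3) (dvdn_gcdl m.+1 m.+3).
  by rewrite (_ : m.+3 - m.+1 = 2)%N //; lia.
by rewrite -muln_lcm_gcd mulnC dvdn_mul // dvdn_lcm d1.
Qed.

Section Packing.
Variables (T : eqType) (f : T -> nat).
Implicit Types (s r : seq T).
Let wsum s := sumn (map f s).

Lemma wsum_cat s r : wsum (s ++ r) = (wsum s + wsum r)%N.
Proof. by rewrite /wsum map_cat sumn_cat. Qed.

Lemma perm_wsum s r : perm_eq s r -> wsum s = wsum r.
Proof. by move=> p; apply/perm_sumn/perm_map. Qed.

Lemma wsum_le m s : {in s, forall x, (f x <= m)%N} -> (wsum s <= size s * m)%N.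
Proof.
elim: s => //= x s IH h; rewrite /wsum /= mulSn leq_add ?h ?mem_head //.
by apply: IH => y ys; apply: h; rewrite inE ys orbT.
Qed.

(** Two of the i+1 prefix sums of the first i terms agree modulo i. *)
Lemma zero_sum_block i s : (0 < i <= size s)%N ->
  exists s1 s2, [/\ perm_eq s (s1 ++ s2), (0 < size s1 <= i)%N & (i %| wsum s1)%N].
Proof.
move=> /andP[i0 le_i].
pose g (a : 'I_i.+1) : 'I_i := Ordinal (ltn_pmod (wsum (take a s)) i0).
have /injectivePn[a [b ab gab]] : ~~ injectiveb g.
  by apply/injectiveP => /leq_card /=; rewrite !card_ord ltnn.
wlog lt_ab : a b ab gab / (a < b)%N.
  move=> H; have [|ba|e] := ltngtP a b; first exact: H.
    by apply: (H b a) => //; rewrite eq_sym.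
  by case/eqP: ab; apply: val_inj.
exists (drop a (take b s)), (take a s ++ drop b s); split.
- rewrite -{1}(cat_take_drop b s) -{1}(cat_take_drop a (take b s)).
  by rewrite take_takel ?(ltnW lt_ab) // -catA perm_catCA perm_refl.
- rewrite size_drop size_takel; last by have := ltn_ord b; lia.
  by have := ltn_ord b; lia.
have E : wsum (take b s) = (wsum (take a s) + wsum (drop a (take b s)))%N.
  by rewrite -wsum_cat -(take_takel s (ltnW lt_ab)) cat_take_drop.
have := congr1 val gab; rewrite /= E => /esym/eqP.
by rewrite -[X in (_ == X %% _)%N]addn0 eqn_modDl mod0n.
Qed.

(** Blocks of weight divisible by i, each of weight at most im, are taken as long as
    they fit below t.  A remainder of fewer than i terms is itself a block,
    because the total is divisible by i. *)
Lemma greedy_blocks m i t s : (0 < i)%N -> {in s, forall x, (f x <= m)%N} ->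
    (i %| wsum s)%N ->
  exists s1 s2, [/\ perm_eq s (s1 ++ s2), (i %| wsum s1)%N, (wsum s1 <= t)%N &
    s2 = [::] \/ (t < wsum s1 + i * m)%N].
Proof.
move=> i0; elim: {s}(size s).+1 {-2}s (ltnSn (size s)) t => // N IH s ltN t lem dv.
case: (posnP (size s)) => [/size0nil ->|s0].
  by exists [::], [::]; split => //; left.
have [b [r [p /andP[b0 bi] db]]] : exists b r,
    [/\ perm_eq s (b ++ r), (0 < size b <= i)%N & (i %| wsum b)%N].
  case: (leqP i (size s)) => [le_is|lt_si].
    by apply: zero_sum_block; rewrite i0.
  by exists s, [::]; rewrite cats0 s0 ltnW.
have lb : (wsum b <= i * m)%N.
  apply: leq_trans (leq_mul bi (leqnn m)); apply: wsum_le => x xb.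
  by apply: lem; rewrite (perm_mem p) mem_cat xb.
have [bt|tb] := leqP (wsum b) t; last first.
  exists [::], s; split => //; right; exact: leq_trans tb lb.
have [] := IH r _ (t - wsum b)%N.
- by have := perm_size p; rewrite size_cat; lia.
- by move=> x xr; apply: lem; rewrite (perm_mem p) mem_cat xr orbT.
- by move: dv; rewrite (perm_wsum p) wsum_cat dvdn_addr.
move=> r1 [r2 [pr d1 le1 alt]].
exists (b ++ r1), r2; split.
- by rewrite (permPl p) -catA perm_cat2l.
- by rewrite wsum_cat dvdn_add.
- by rewrite wsum_cat; lia.
- by case: alt => [|alt]; [left | right]; rewrite ?wsum_cat //; lia.
Qed.

Lemma sum_const_weight i s : {in s, forall x, f x = i} -> wsum s = (size s * i)%N.
Proof.
elim: s => //= x s IH h; rewrite /wsum /= mulSn h ?mem_head //; congr addn.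
by apply: IH => y ys; apply: h; rewrite inE ys orbT.
Qed.

Lemma wsum_count m s : {in s, forall x, (f x <= m)%N} ->
  wsum s = (\sum_(i < m.+1) i * count (fun x => f x == i) s)%N.
Proof.
elim: s => [|x s IH] h; first by rewrite big1 // => i _; rewrite muln0.
rewrite /wsum /= -/(wsum s) IH; last by move=> y ys; apply: h; rewrite inE ys orbT.
under [in RHS]eq_bigr do rewrite mulnDr.
rewrite big_split /=; congr addn.
have lt_x : (f x < m.+1)%N by rewrite ltnS h ?mem_head.
rewrite (bigD1 (Ordinal lt_x)) //= eqxx muln1 big1 ?addn0 // => i ne.
by rewrite -val_eqE /= eq_sym in ne; rewrite (negbTE ne) muln0.
Qed.

(** Otherwise each weight i occurs at most m-2 times, and the total is at most
    (m-2)m(m+1)/2, which is smaller than 2k by [leq_lcm_range]. *)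
Lemma frequent_weight m k j s : (0 < k)%N ->
    (forall i, (1 <= i <= m)%N -> (i %| k)%N) ->
    {in s, forall x, (1 <= f x <= m)%N} -> wsum s = (j.+2 * k)%N ->
  exists2 i, (1 <= i <= m)%N & (m.-1 <= count (fun x => f x == i) s)%N.
Proof.
move=> k0 dvd w12 ws.
have m0 : (0 < m)%N.
  case: s w12 ws => [|x s] h; first by rewrite /wsum /=; lia.
  by have := h x (mem_head _ _); lia.
apply: contrapT => H.
have cnt i : (1 <= i <= m)%N -> (count (fun x => f x == i) s <= m - 2)%N.
  move=> im; rewrite leqNgt; apply/negP => lt; apply: H; exists i => //; lia.
have [m1|m2] : m = 1%N \/ (1 < m)%N by lia.
  by apply: H; exists 1%N; rewrite ?m1.
have := leq_lcm_range m2 k0 dvd.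
have : (wsum s * 2 <= (m - 2) * (m * m.+1))%N.
  rewrite (@wsum_count m); last by move=> x /w12/andP[].
  have -> : (m * m.+1 = (\sum_(i < m.+1) i) * 2)%N.
    elim: m {H m0 m2 cnt w12 dvd} => [|m IH]; rewrite big_ord_recr /= ?big_ord0 //.
    by rewrite mulnDl -IH; nia.
  rewrite mulnA leq_mul2r /= big_distrr /=; apply: leq_sum => i _.
  rewrite mulnC; case: (posnP i) => [->|i0]; first by rewrite !muln0.
  by rewrite leq_mul2r cnt ?orbT // i0 -ltnS ltn_ord.
rewrite ws => le1 le2; have h3 : (3 <= m)%N by nia.
have [m3|m4] : m = 3 \/ (3 < m)%N by lia.
  have : (6 <= k)%N; last by move: le1; rewrite m3; nia.
  by apply: dvdn_leq => //; rewrite (@Gauss_dvd 2 3) // !dvd // m3.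
case: m m4 le1 le2 {m0 m2 h3 cnt H w12 dvd} => [|[|[|[|m]]]] // _.
rewrite !subSS subn0 /= => le1 le2; nia.
Qed.

(** One weight i is frequent.  The other terms are packed in blocks of weight
    divisible by i until the missing weight is less than im; as it is a multiple
    of i, it is at most i(m-1), and is supplied by terms of weight i. *)
Lemma sub_packing m k j s : (0 < k)%N ->
    (forall i, (1 <= i <= m)%N -> (i %| k)%N) ->
    {in s, forall x, (1 <= f x <= m)%N} -> wsum s = (j.+1 * k)%N ->
  exists s1 s2, perm_eq s (s1 ++ s2) /\ wsum s1 = k.
Proof.
move=> k0 dvd w12; case: j => [|j] ws.
  by exists s, [::]; rewrite cats0 ws mul1n.
have [i im lei] := frequent_weight k0 dvd w12 ws.
have ik := dvd i im.
(* the terms of weight i are kept aside to fill the final gap *)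
set a := fun x => f x == i in lei.
have p : perm_eq s (filter a s ++ filter (predC a) s) by rewrite perm_sym perm_filterC.
have wa t : {subset t <= filter a s} -> wsum t = (size t * i)%N.
  by move=> h; apply: sum_const_weight => x /h; rewrite mem_filter => /andP[/eqP].
have tot := perm_wsum p; rewrite wsum_cat ws wa // size_filter in tot.
have [| | |r1 [r2 [pr d1 le1 alt]]] := @greedy_blocks m i k (filter (predC a) s).
- by case/andP: im.
- by move=> x; rewrite mem_filter => /andP[_ /w12/andP[]].
- have : (i %| j.+2 * k)%N by rewrite dvdn_mull.
  by rewrite tot dvdn_addr // dvdn_mull.
have [q gap] : exists q, (k - wsum r1 = q * i)%N.
  by have /dvdnP[q] := dvdn_sub ik d1; exists q.
have qle : (q <= count a s)%N.
  case: alt => [r2E|lt].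
    move: (perm_wsum pr); rewrite r2E cats0 => E; rewrite E in tot.
    have i0 : (0 < i)%N by case/andP: im.
    rewrite -(leq_pmul2r i0) -gap; nia.
  apply: leq_trans lei; have : (q * i < i * m)%N by rewrite -gap; lia.
  by case/andP: im => i0 _; rewrite mulnC ltn_pmul2l //; lia.
exists (take q (filter a s) ++ r1), (drop q (filter a s) ++ r2); split.
  rewrite (permPl p) -{1}(cat_take_drop q (filter a s)) -!catA perm_cat2l.
  by rewrite perm_sym perm_catCA perm_cat2l perm_sym.
rewrite wsum_cat wa; last by move=> x; apply: mem_take.
by rewrite size_takel ?size_filter // -gap subnK.
Qed.

End Packing.

(** * Polynomials separated by a Kronecker substitution *)

(** Substituting for the i-th variable a monic polynomial of degree N^i gives
    distinct degrees to the monomials of a polynomial p with exponents below N,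
    so the substituted polynomial has a coefficient of p as leading coefficient.
    The powers of a variable T themselves make p univariate; the shifts X_i + T^(N^i)
    turn p into a polynomial with constant leading coefficient, as in Noether
    normalization. *)
Section Kronecker.
Variables (n N : nat).

Definition kexp (m : 'X_{1..n}) : nat := (\sum_(i < n) m i * N ^ i)%N.

(** Uniqueness of the digits in base N. *)
Lemma kexp_inj (m1 m2 : 'X_{1..n}) :
    (forall i, (m1 i < N)%N) -> (forall i, (m2 i < N)%N) ->
  kexp m1 = kexp m2 -> m1 = m2.
Proof.
move=> h1 h2 E; apply/mnmP; move: E; rewrite /kexp.
move: (m1 : 'I_n -> nat) (m2 : 'I_n -> nat) h1 h2 => f g.
elim: n f g => [|l IH] f g hf hg E i; first by case: i.
have N0 : (0 < N)%N by apply: leq_ltn_trans (hf ord0).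
have S (h : 'I_l.+1 -> nat) : (\sum_(i < l.+1) h i * N ^ i =
    (\sum_(i < l) h (lift ord0 i) * N ^ i) * N + h ord0)%N.
  rewrite big_ord_recl expn0 muln1 addnC; congr addn.
  by rewrite big_distrl; apply: eq_bigr => j _ /=; rewrite expnSr mulnA.
rewrite !S in E; have E0 : f ord0 = g ord0.
  by have := congr1 (modn^~ N) E; rewrite !modnMDl !modn_small.
rewrite E0 in E; move/addIn/eqP: E; rewrite eqn_pmul2r // => /eqP E.
case: (unliftP ord0 i) => [j|] -> //.
by apply: (IH (fun j => f (lift ord0 j)) (fun j => g (lift ord0 j))).
Qed.

Variables (K : nzRingType) (A : comNzRingType) (f : {rmorphism K -> A}).
Variable kappa : 'I_n -> {poly A}.
Hypothesis kappa_monic : forall i, kappa i \is monic.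
Hypothesis kappa_size : forall i, size (kappa i) = (N ^ i).+1.

Lemma kronecker_monomial (m : 'X_{1..n}) :
  mmap1 kappa m \is monic /\ size (mmap1 kappa m) = (kexp m).+1.
Proof.
rewrite /mmap1 /kexp; split.
  by apply: monic_prod => i _; rewrite monic_exp.
have mP (I : seq 'I_n) : \prod_(i <- I) kappa i ^+ m i \is monic.
  by apply: monic_prod => i _; rewrite monic_exp.
suff H (I : seq 'I_n) : size (\prod_(i <- I) kappa i ^+ m i) =
  (\sum_(i <- I) m i * N ^ i).+1 by rewrite H.
elim: I => [|i I IH]; first by rewrite !big_nil size_poly1.
rewrite !big_cons size_Mmonic ?IH ?mP //; last first.
  by rewrite monic_neq0 ?monic_exp.
suff -> : size (kappa i ^+ m i) = (m i * N ^ i).+1 by rewrite addSn addnS.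
elim: (m i) => [|e IHe]; first by rewrite expr0 size_poly1.
rewrite exprS size_Mmonic ?IHe ?monic_exp ?monic_neq0 //.
by rewrite kappa_size addSn addnS mulSn.
Qed.

Lemma kronecker_lead (p : {mpoly K[n]}) : p != 0 ->
    (forall m, m \in msupp p -> forall i, (m i < N)%N) ->
  exists2 m, m \in msupp p &
    (size (mmap (polyC \o f) kappa p) <= (kexp m).+1)%N /\
    (mmap (polyC \o f) kappa p)`_(kexp m) = f p@_m.
Proof.
move=> p0 small.
have [m0 m0p] : exists m0, m0 \in msupp p by exists (mlead p); apply: mlead_supp.
have [m mp max] : exists2 m, m \in msupp p &
    {in msupp p, forall m', (kexp m' <= kexp m)%N}.
  pose P e := has (fun m => kexp m == e) (msupp p).
  have eP : exists e, P e by exists (kexp m0); apply/hasP; exists m0.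
  have uP e : P e -> (e <= \max_(m <- msupp p) kexp m)%N.
    by case/hasP => m mp /eqP <-; apply: leq_bigmax_seq.
  case: (ex_maxnP eP uP) => e /hasP[m mp /eqP <-] h.
  by exists m => // m' m'p; apply: h; apply/hasP; exists m'.
exists m => //; rewrite /mmap; split.
  rewrite big_seq; apply: (leq_trans (size_sum _ _ _)); apply/bigmax_leqP_seq => m' m'p _.
  rewrite /= mul_polyC; apply: leq_trans (size_scale_leq _ _) _.
  by have [_ ->] := kronecker_monomial m'; rewrite ltnS max.
rewrite coef_sum (bigD1_seq m) //= coefCM.
have [mm sm] := kronecker_monomial m.
have := mm; rewrite monicE lead_coefE sm /= => /eqP ->; rewrite mulr1.
rewrite big_seq_cond big1 ?addr0 // => m' /andP[m'p ne].
rewrite coefCM nth_default ?mulr0 //.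
have [_ ->] := kronecker_monomial m'.
rewrite ltn_neqAle max // andbT; apply: contra ne => /eqP E.
by apply/eqP/kexp_inj => // i; apply: small.
Qed.

End Kronecker.

Lemma msupp_lt_msize (K : nzRingType) n (p : {mpoly K[n]}) :
  forall m, m \in msupp p -> forall i, (m i < msize p)%N.
Proof.
move=> m mp i; apply: leq_ltn_trans (msize_mdeg_lt mp).
by rewrite mdegE (bigD1 i) //= leq_addr.
Qed.

Lemma poly_nat_nonroot (K : numDomainType) (p : {poly K}) : p != 0 ->
  exists a : nat, p.[a%:R] != 0.
Proof.
move=> p0; apply: contrapT => H.
suff [ha hu] : all (root p) [seq i%:R | i <- iota 0 (size p)] /\
    uniq ([seq i%:R | i <- iota 0 (size p)] : seq K).
  by have := max_poly_roots p0 ha hu; rewrite size_map size_iota ltnn.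
split.
  apply/allP => _ /mapP[a _ ->]; apply/rootP.
  by apply: contrapT => /eqP h; apply: H; exists a.
by rewrite map_inj_uniq ?iota_uniq // => i j /eqP; rewrite eqr_nat => /eqP.
Qed.

Lemma horner_mmap (K : comNzRingType) n (kappa : 'I_n -> {poly K}) p x :
  (mmap polyC kappa p).[x] = p.@[fun i => (kappa i).[x]].
Proof.
rewrite mevalE horner_sum; apply: eq_bigr => m _.
rewrite hornerCM horner_prod; congr (_ * _).
by apply: eq_bigr => i _; rewrite horner_exp.
Qed.

(** The Kronecker substitution T^(N^i) gives a non-zero univariate polynomial. *)
Lemma mpoly_nat_nonroot (K : numDomainType) n (p : {mpoly K[n]}) : p != 0 ->
  exists a : 'I_n -> nat, p.@[fun i => (a i)%:R] != 0.
Proof.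
move=> p0; set N := msize p.
pose kappa (i : 'I_n) : {poly K} := 'X^(N ^ i).
have mk i : kappa i \is monic by apply: monicXn.
have sk i : size (kappa i) = (N ^ i).+1 by rewrite size_polyXn.
have [m mp [_ cm]] := @kronecker_lead n N K K idfun kappa mk sk p p0 (@msupp_lt_msize _ _ p).
have q0 : mmap polyC kappa p != 0.
  by apply: contraTneq mp => q0; rewrite mcoeff_msupp -[p@_m]cm q0 coef0 eqxx.
have [a] := poly_nat_nonroot q0; rewrite horner_mmap => qa.
exists (fun i => (a ^ (N ^ i))%N);
  rewrite (meval_eq (v2 := fun i => (kappa i).[a%:R])) //.
by move=> i; rewrite hornerXn natrX.
Qed.

Lemma mpoly_eq_eval (K : numDomainType) n (p q : {mpoly K[n]}) :
  (forall v : 'rV[K]_n, p.@[v 0] = q.@[v 0]) -> p = q.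
Proof.
move=> H; apply/eqP; rewrite -subr_eq0; apply: contrapT => /negP/mpoly_nat_nonroot.
case=> a /eqP; apply; rewrite mevalB.
have e r : r.@[fun i => (a i)%:R] = r.@[(\row_i (a i)%:R : 'rV[K]_n) 0].
  by apply: meval_eq => i; rewrite mxE.
by rewrite !e H subrr.
Qed.

(** * Polynomial rings are integrally closed *)

(** Integral closedness of F[T]: once a and b are divided by their gcd, the
    equation shows that b divides a power of a, hence is a unit. *)
Lemma poly_dvd_of_integral (F : fieldType) (a b : {poly F}) N
    (c : 'I_N -> {poly F}) : b != 0 ->
  a ^+ N = \sum_(i < N) c i * a ^+ i * b ^+ (N - i) -> b %| a.
Proof.
move=> b0 E; set g := gcdp a b.
have g0 : g != 0 by rewrite gcdp_eq0 (negbTE b0) andbF.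
have [ga gb] : g %| a /\ g %| b by rewrite dvdp_gcdl dvdp_gcdr.
set a' := a %/ g; set b' := b %/ g.
have aE : a = a' * g by rewrite divpK.
have bE : b = b' * g by rewrite divpK.
have cop : coprimep a' b' by apply: coprimep_div_gcd; rewrite b0 orbT.
have E' : a' ^+ N = \sum_(i < N) c i * a' ^+ i * b' ^+ (N - i).
  apply: (mulIf (expf_neq0 N g0)); rewrite -exprMn -aE E mulr_suml.
  apply: eq_bigr => i _; rewrite aE bE !exprMn.
  have -> : g ^+ N = g ^+ i * g ^+ (N - i) by rewrite -exprD subnKC // ltnW.
  by ring.
have dv : b' %| a' ^+ N.
  rewrite E'; apply: (big_ind (fun x => b' %| x)) => [|x y dx dy|i _]; first exact: dvdp0.
    by rewrite dvdp_addr.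
  by apply: dvdp_mull; rewrite -(@prednK (N - i)) ?subn_gt0 // exprS dvdp_mulr.
have : b' %= 1.
  have cN : coprimep (a' ^+ N) b' by apply: coprimep_expl.
  rewrite coprimep_sym in cN.
  by rewrite -size_poly_eq1 -dvdp1 -(Gauss_dvdpr _ cN) mulr1.
move=> b1; rewrite aE bE mulrC [a' * g]mulrC dvdp_mul2l //.
by rewrite (eqp_dvdl _ b1) dvd1p.
Qed.

(** The substitution X_i -> X_i + T^(e^i) makes b, up to a constant, monic in T, so
    that a can be divided by b with a remainder r.  At every point x, the
    univariate case shows that b divides a in K[T], so r vanishes at x by degree.
    Hence r = 0, and T = 0 gives the quotient of a by b. *)
Lemma mpoly_dvd_of_integral (K : numFieldType) n (a b : {mpoly K[n]}) N
    (c : 'I_N -> {mpoly K[n]}) : b != 0 ->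
  a ^+ N = \sum_(i < N) c i * a ^+ i * b ^+ (N - i) -> exists q, a = b * q.
Proof.
move=> b0 E; set e := msize b.
have e0 i : (0 < e ^ i)%N by rewrite expn_gt0 lt0n mmeasure_poly_eq0 b0.
pose kappa (i : 'I_n) : {poly {mpoly K[n]}} := 'X^(e ^ i) + ('X_i)%:P.
have mk i : kappa i \is monic by rewrite /kappa; exact: monicXnaddC (e0 i).
have sk i : size (kappa i) = (e ^ i).+1 by rewrite /kappa size_XnaddC ?e0.
have [m mb [sz lc]] := @kronecker_lead n e K {mpoly K[n]} (@mpolyC n K) kappa mk sk b b0
  (@msupp_lt_msize _ _ b).
have [th thE] : exists th : {rmorphism {mpoly K[n]} -> {poly {mpoly K[n]}}},
    forall p, mmap (polyC \o @mpolyC n K) kappa p = th p.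
  by exists (mmap (polyC \o @mpolyC n K) kappa).
rewrite !thE in sz lc.
have bm0 : b@_m != 0 by rewrite -mcoeff_msupp.
pose u : {mpoly K[n]} := ((b@_m)^-1)%:MP.
have u1 : u * (b@_m)%:MP = 1 by rewrite -mpolyCM mulVf.
pose d := u *: th b.
have dm : d \is monic.
  have cd : d`_(kexp e m) = 1 by rewrite coefZ [X in _ * X]lc u1.
  have sd : size d = (kexp e m).+1.
    apply/eqP; rewrite eqn_leq (leq_trans (size_scale_leq _ _) sz) /=.
    by rewrite ltnNge; apply/negP => /leq_sizeP/(_ _ (leqnn _))/eqP; rewrite cd oner_eq0.
  by rewrite monicE lead_coefE sd cd.
have dE := Pdiv.RingMonic.rdivp_eq dm (th a).
set q := Pdiv.Ring.rdivp _ _ in dE; set r := Pdiv.Ring.rmodp _ _ in dE.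
have r0 : r = 0.
  apply/polyP => j; rewrite coef0; apply: mpoly_eq_eval => v; rewrite meval0.
  set ev := map_poly (meval (v 0)).
  have [h hE] : exists h : {rmorphism {mpoly K[n]} -> {poly K}}, forall p, ev (th p) = h p.
    by exists (map_poly (meval (v 0)) \o th).
  have dm' : ev d \is monic by apply: monic_map.
  have thd : th b = (b@_m)%:MP *: d by rewrite scalerA mulrC u1 scale1r.
  have eb : ev (th b) = b@_m *: ev d by rewrite thd /ev map_polyZ /= mevalC.
  have : ev (th b) %| ev (th a).
    apply: (@poly_dvd_of_integral _ _ _ N (fun i => ev (th (c i)))).
      by rewrite eb scaler_eq0 (negbTE bm0) monic_neq0.
    rewrite !hE -rmorphXn E rmorph_sum.
    by apply: eq_bigr => i _; rewrite hE !rmorphM !rmorphXn.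
  rewrite eb dvdpZl // dE /ev rmorphD rmorphM /= dvdp_addr ?dvdp_mull //.
  move=> dvr; suff : map_poly (meval (v 0)) r = 0 by move/(congr1 (coefp j));
    rewrite /= coef_map /= coef0.
  apply/eqP; apply: contraT => r0; have := dvdp_leq r0 dvr.
  have sd : size (map_poly (meval (v 0)) d) = size d.
    by rewrite size_map_poly_id0 // (monicP dm) meval1 oner_neq0.
  by rewrite leqNgt sd (leq_ltn_trans (size_poly _ _)) // Pdiv.Ring.ltn_rmodpN0 ?monic_neq0.
have at0 p : (th p).[0] = p.
  rewrite -thE horner_sum [RHS]mpolyE; apply: eq_bigr => m' _.
  rewrite /= hornerCM mul_mpolyC horner_prod mpolyXE_id; congr (_ *: _).
  apply: eq_bigr => i _; rewrite horner_exp hornerD hornerXn hornerC expr0n.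
  by rewrite (negbTE (lt0n_neq0 (e0 i))) add0r.
exists (q.[0] * u); rewrite -[LHS]at0 dE r0 addr0 hornerM hornerZ at0; ring.
Qed.

(** * Weighted degree and homogeneous coordinates *)

Section WeightedDegree.
Variables (n : nat) (w : 'I_n -> nat).
Implicit Types M : 'X_{1..n}.

Lemma wdeg_mnm1 i : wdeg w U_(i) = w i.
Proof.
rewrite /wdeg (bigD1 i) //= mnm1E eqxx muln1 big1 ?addn0 // => j ne.
by rewrite mnm1E eq_sym (negbTE ne) muln0.
Qed.

Lemma wdegMn M j : wdeg w (M *+ j) = (wdeg w M * j)%N.
Proof. by rewrite /wdeg big_distrl; apply: eq_bigr => i _; rewrite mulmnE mulnA. Qed.

Lemma wdeg_sum_mnm1 (s : seq 'I_n) :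
  wdeg w (\sum_(i <- s) U_(i))%MM = sumn (map w s).
Proof.
elim: s => [|i s IH]; first by rewrite big_nil wdeg0.
by rewrite big_cons wdegD IH wdeg_mnm1.
Qed.

Lemma mnm_seq M : exists s : seq 'I_n, M = (\sum_(i <- s) U_(i))%MM.
Proof.
exists (flatten [seq nseq (M i) i | i <- enum 'I_n]).
rewrite big_flatten big_map big_enum /= {1}[M]multinomUE_id; apply: eq_bigr => i _.
rewrite big_nseq; elim: (M i) => [|j IH]; first by rewrite mulm0n.
by rewrite mulmS IH.
Qed.

Lemma monomial_packing m k M j : (forall i, (1 <= w i <= m)%N) -> (0 < k)%N ->
    (forall i, (1 <= i <= m)%N -> (i %| k)%N) -> wdeg w M = (j.+1 * k)%N ->
  exists M1 M2, M = (M1 + M2)%MM /\ wdeg w M1 = k.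
Proof.
move=> wb k0 dvd; have [s ->] := mnm_seq M; rewrite wdeg_sum_mnm1 => ws.
have [|s1 [s2 [p s1k]]] := @sub_packing _ w m k j s k0 dvd _ ws; first by move=> i _;
  apply: wb.
exists (\sum_(i <- s1) U_(i))%MM, (\sum_(i <- s2) U_(i))%MM.
by rewrite (perm_big _ p) big_cat wdeg_sum_mnm1.
Qed.

Lemma wdeg_eq0 M : (forall i, (0 < w i)%N) -> wdeg w M = 0%N -> M = 0%MM.
Proof.
move=> w0 /eqP; rewrite /wdeg sum_nat_eq0 => /forallP h; apply/mnmP => i.
have := h i; rewrite mnm0E /= muln_eq0 => /orP[|/eqP //].
by rewrite -leqn0 leqNgt w0.
Qed.

(** The case t = 0 evaluates forms at the origin. *)
Lemma dhomog_scale (K : comNzRingType) D (p : {mpoly K[n]}) t (u v : 'I_n -> K) :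
    p \is D.-homog for (wdeg w) -> (forall i, v i = t ^+ w i * u i) ->
  p.@[v] = t ^+ D * p.@[u].
Proof.
move=> /dhomogP hp vE; rewrite !mevalE mulr_sumr; apply: eq_big_seq => M /hp <-.
rewrite mulrCA; congr (_ * _).
under eq_bigr do rewrite vE exprMn -exprM.
by rewrite big_split /= prodrXr.
Qed.

End WeightedDegree.

Lemma wdeg_std n (M : 'X_{1..n}) : wdeg (@std_weight n) M = mdeg M.
Proof. by rewrite mdegE; apply: eq_bigr => i _; rewrite mul1n. Qed.

Lemma dhomog_comp (K : comNzRingType) n N (w : 'I_n -> nat) k D
    (G : N.-tuple {mpoly K[n]}) (q : {mpoly K[N]}) :
    (forall j, tnth G j \is k.-homog for (wdeg w)) ->
    q \is D.-homog for (wdeg (@std_weight N)) ->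
  q \mPo G \is (k * D).-homog for (wdeg w).
Proof.
move=> hG /dhomogP hq; rewrite comp_mpolyEX big_seq; apply: rpred_sum => M /hq <-.
apply: rpredZ; rewrite comp_mpolyX /= wdeg_std mdegE big_distrr /=.
elim: (index_enum _) => [|j s IH]; first by rewrite !big_nil; exact: dhomog1.
by rewrite !big_cons; apply: dhomogM => //; apply: dhomogMn.
Qed.

Section Coordinates.
Variables (K : fieldType) (n : nat) (w : 'I_n -> nat).
Implicit Types (x : wproj K w) (u v : 'rV[K]_n).

Lemma hcoord_neq0 x : hcoord x != 0.
Proof. exact: valP (repr x). Qed.

Lemma wpoint_eqP u v (hu : u != 0) (hv : v != 0) :
  wpoint w hu = wpoint w hv <-> wscaled w u v.
Proof.
split; first by move=> /eqmodP /asboolP.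
by move=> h; apply/eqmodP/asboolP.
Qed.

Lemma wpoint_hcoord x (h : hcoord x != 0) : wpoint w h = x.
Proof.
rewrite /wpoint /hcoord -[RHS]reprK; congr (\pi _).
by apply: val_inj.
Qed.

Lemma hcoord_wpoint v (hv : v != 0) :
  exists2 t, t != 0 & forall i, hcoord (wpoint w hv) 0 i = t ^+ w i * v 0 i.
Proof.
apply/wpoint_eqP; first exact: hcoord_neq0.
by move=> h; rewrite wpoint_hcoord.
Qed.

(** The coordinates chosen by [hcoord] may be replaced by any others in statements
    on the vanishing of forms. *)
Lemma dhomog_hcoord_eq0 D (p : {mpoly K[n]}) v (hv : v != 0) :
  p \is D.-homog for (wdeg w) ->
  p.@[hcoord (wpoint w hv) 0] = 0 <-> p.@[v 0] = 0.
Proof.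
move=> hp; have [t t0 E] := hcoord_wpoint hv; rewrite (dhomog_scale hp E).
split=> [/eqP|->]; last by rewrite mulr0.
by rewrite mulf_eq0 expf_eq0 (negbTE t0) andbF => /eqP.
Qed.

End Coordinates.

(** * Points of the Veronese ring of a weighted polynomial ring *)

(** A homomorphism to K from the ring spanned by the monomials of degree divisible by
    k is a multiplicative function [eta] on these monomials.  It extends to all
    monomials: on the variables with non-zero [eta], the monomials of degree
    divisible by k have finite index in a free abelian group, and K^* is divisible.
    Exponents are kept non-negative by working modulo k. *)
Section Toric.
Variables (n : nat) (w : 'I_n -> nat) (k : nat).
Hypotheses (w0 : forall i, (0 < w i)%N) (wk : forall i, (w i %| k)%N) (k0 : (0 < k)%N).
Implicit Types M : 'X_{1..n}.

(** Bezout coefficients for the weights in J, made non-negative modulo k: g is a gcd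
    of these weights and k, and b is a monomial in the variables of J. *)
Lemma bezout_monomial (J : pred 'I_n) : exists (b : 'X_{1..n}) (g : nat),
  [/\ (0 < g)%N, (g %| k)%N, forall i, J i -> (g %| w i)%N,
      forall i, b i != 0%N -> J i & (wdeg w b = g %[mod k])%N].
Proof.
suff [b [g [g0 gk gw bs bg]]] : exists (b : 'X_{1..n}) (g : nat),
  [/\ (0 < g)%N, (g %| k)%N, {in enum J, forall i, (g %| w i)%N},
      forall i, b i != 0%N -> i \in enum J & (wdeg w b = g %[mod k])%N].
  exists b, g; split => // i; first by move=> Ji; apply: gw; rewrite mem_enum.
  by move/bs; rewrite mem_enum.
elim: (enum J) => [|i s [b [g [g0 gk gw bs bg]]]].
  exists 0%MM, k; split => //; first by move=> i; rewrite mnm0E.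
  by rewrite wdeg0 modnn mod0n.
have [a _ /dvdnP[c ac]] := Bezoutl (w i) g0.
(* subtracting a U_i is, modulo k, adding a (k - 1) of them *)
exists (b *+ c + U_(i) *+ (a * k.-1))%MM, (gcdn g (w i)); split.
- by rewrite gcdn_gt0 g0.
- exact: dvdn_trans (dvdn_gcdl _ _) gk.
- move=> j; rewrite inE => /predU1P[->|/gw]; first exact: dvdn_gcdr.
  exact: dvdn_trans (dvdn_gcdl _ _).
- move=> j; rewrite mnmDE !mulmnE mnm1E inE; have [->|ne] := eqVneq j i; first by [].
  rewrite mul0n addn0 muln_eq0 => /norP[/bs ->]; by rewrite orbT.
rewrite wdegD !wdegMn wdeg_mnm1 -modnDml -modnMml bg modnMml modnDml.
rewrite mulnC -ac (_ : _ + _ = gcdn g (w i) + a * w i * k)%N;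
  last by case: (k) k0 => //= l _; nia.
by rewrite addnC modnMDl.
Qed.

Variable K : numClosedFieldType.

Lemma wdeg_axis i : wdeg w (U_(i) *+ (k %/ w i)) = k.
Proof. by rewrite wdegMn wdeg_mnm1 mulnC divnK. Qed.

Lemma mulmnA M a b : (M *+ (a * b) = M *+ a *+ b)%MM.
Proof. by apply/mnmP => i; rewrite !mulmnE mulnA. Qed.

Section Point.
Variable eta : 'X_{1..n} -> K.
Hypothesis eta0 : eta 0%MM = 1.
Hypothesis etaD : forall M M', (k %| wdeg w M)%N -> (k %| wdeg w M')%N ->
  eta (M + M')%MM = eta M * eta M'.

Lemma wdeg_sum_dvd (I : Type) (s : seq I) (F : I -> 'X_{1..n}) :
  (forall i, (k %| wdeg w (F i))%N) -> (k %| wdeg w (\sum_(i <- s) F i)%MM)%N.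
Proof.
move=> h; elim: s => [|i s IH]; first by rewrite big_nil wdeg0.
by rewrite big_cons wdegD dvdn_add.
Qed.

Lemma eta_sum (I : Type) (s : seq I) (F : I -> 'X_{1..n}) :
  (forall i, (k %| wdeg w (F i))%N) ->
  eta (\sum_(i <- s) F i)%MM = \prod_(i <- s) eta (F i).
Proof.
move=> h; elim: s => [|i s IH]; first by rewrite !big_nil.
by rewrite !big_cons etaD ?IH //; apply: wdeg_sum_dvd.
Qed.

Lemma eta_muln M j : (k %| wdeg w M)%N -> eta (M *+ j)%MM = eta M ^+ j.
Proof.
move=> h; elim: j => [|j IH]; first by rewrite mulm0n.
by rewrite mulmS etaD ?IH ?exprS // wdegMn dvdn_mulr.
Qed.

Let supp i := eta (U_(i) *+ (k %/ w i))%MM != 0.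

(** The k-th power of [eta M] is a product of powers of the values of [eta] at the
    monomials X_i^(k / w_i). *)
Lemma eta_neq0 M : (k %| wdeg w M)%N ->
  (eta M != 0) = [forall i, (M i != 0%N) ==> supp i].
Proof.
move=> dM; have : eta M ^+ k = \prod_(i < n) eta (U_(i) *+ (k %/ w i))%MM ^+ (w i * M i).
  rewrite -eta_muln //.
  have -> : (M *+ k = \sum_(i < n) U_(i) *+ (k %/ w i) *+ (w i * M i))%MM.
    apply/mnmP => i; rewrite mnm_sumE (bigD1 i) //= big1 ?addn0 => [|j ne].
      by rewrite !mulmnE mnm1E eqxx mul1n mulnA divnK // mulnC.
    by rewrite !mulmnE mnm1E (negbTE ne).
  rewrite eta_sum => [|i]; last by rewrite wdegMn wdeg_axis dvdn_mulr.
  by apply: eq_bigr => i _; rewrite eta_muln // wdeg_axis.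
move=> E; have -> : (eta M != 0) = (eta M ^+ k != 0) by rewrite expf_eq0 k0.
rewrite E; apply/prodf_neq0/forallP => h i.
  apply/implyP => Mi; have := h i isT; rewrite expf_eq0 muln_gt0 w0 lt0n Mi; exact.
move=> _; rewrite expf_eq0 muln_gt0 w0 lt0n.
by apply/negP => /andP[Mi]; apply/negP; apply: (implyP (h i)).
Qed.

(** With b of degree g modulo k, the value of the extension at b must be a
    (k/g)-th root t of [eta (b *+ (k %/ g))].  The degree of X_i b^(k - w_i/g) is
    divisible by k, which forces u_i t^(k - w_i/g) = eta(X_i b^(k - w_i/g)). *)
Lemma toric_point : exists u : 'I_n -> K,
  forall M, (k %| wdeg w M)%N -> eta M = \prod_i u i ^+ M i.
Proof.
have [b [g [g0 gk gw bs bg]]] := bezout_monomial supp.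
set r := (k %/ g)%N.
have r0 : (0 < r)%N by rewrite divn_gt0 // dvdn_leq.
have kE : k = (r * g)%N by rewrite divnK.
have dbr : (k %| wdeg w (b *+ r))%N.
  by rewrite wdegMn /dvdn -modnMml bg modnMml mulnC -kE modnn.
have br0 : eta (b *+ r)%MM != 0.
  rewrite eta_neq0 //; apply/forallP => i; rewrite mulmnE muln_eq0.
  by apply/implyP => /norP[/bs].
set t := r.-root (eta (b *+ r)%MM).
have tr : t ^+ r = eta (b *+ r)%MM by rewrite rootCK.
have t0 : t != 0 by move: br0; rewrite -tr expf_eq0 r0.
pose Mi i := (U_(i) + b *+ (k - w i %/ g))%MM.
have dMi i : supp i -> (k %| wdeg w (Mi i))%N.
  move=> si; rewrite wdegD wdegMn wdeg_mnm1 /dvdn -modnDmr -modnMml bg modnMml modnDmr.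
  rewrite mulnBr [(g * (w i %/ g))%N]mulnC divnK ?gw // subnKC ?modnMl //.
  by rewrite (leq_trans (dvdn_leq k0 (wk i))) // leq_pmull.
(* the factor t^k stands for eta (b *+ k) *)
exists (fun i => if supp i then eta (Mi i) * t ^+ (w i %/ g) / t ^+ k else 0) => M dM.
have [/forallP sM|] := boolP [forall i, (M i != 0%N) ==> supp i]; last first.
  rewrite negb_forall => /existsP[] i; rewrite negb_imply => /andP[Mi0 si];
    rewrite (bigD1 i) //= (negbTE si) expr0n.
  rewrite (negbTE Mi0) mul0r; apply/eqP; apply: contraNT si.
  by rewrite eta_neq0 // => /forallP/(_ i)/implyP; apply.
have sM' i : M i = 0%N \/ supp i.
  by have := sM i; case: eqP => [->|_ /=]; [left | right].
have -> : \prod_i (if supp i then eta (Mi i) * t ^+ (w i %/ g) / t ^+ k else 0) ^+ M i =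
   \prod_i (eta (Mi i *+ M i)%MM * t ^+ (w i %/ g * M i) / t ^+ (k * M i)).
  apply: eq_bigr => i _; case: (sM' i) => [->|si].
    by rewrite !muln0 !expr0 mulm0n eta0 invr1 !mulr1.
  by rewrite si eta_muln ?dMi // !exprM expr_div_n exprMn.
rewrite !big_split /= prodfV !prodrXr -eta_sum; last first.
  by move=> i; rewrite wdegMn; case: (sM' i) => [->|/dMi]; rewrite ?muln0 ?dvdn0 //;
    apply: dvdn_mulr.
set E := (\sum_i w i %/ g * M i)%N.
pose Z := (\sum_i (k - w i %/ g) * M i)%N.
have EZ : (\sum_i k * M i = Z + E)%N.
  rewrite -big_split; apply: eq_bigr => i _ /=; rewrite -mulnDl subnK //.
  by rewrite (leq_trans (leq_div _ _)) // dvdn_leq.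
have gE : (E * g = wdeg w M)%N.
  rewrite big_distrl; apply: eq_bigr => i _ /=; case: (sM' i) => [->|si].
    by rewrite !muln0.
  by rewrite mulnAC divnK // gw.
have rE : (r %| E)%N.
  by rewrite -(dvdn_pmul2r g0) gE -kE.
have /dvdnP[z zE] : (r %| Z)%N.
  rewrite -(dvdn_addl _ rE) -EZ; apply: dvdn_sum => i _.
  by rewrite dvdn_mulr // kE dvdn_mulr.
have -> : (\sum_i Mi i *+ M i = M + b *+ Z)%MM.
  apply/mnmP => j; rewrite mnm_sumE mnmDE mulmnE big_distrr /=.
  under eq_bigr do rewrite mulmnE mnmDE mulmnE mnm1E mulnDl.
  rewrite big_split /=; congr addn; last by apply: eq_bigr => i _; rewrite mulnA.
  rewrite (bigD1 j) //= eqxx mul1n big1 ?addn0 // => i ne.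
  by rewrite (negbTE ne).
have Zr : (b *+ Z = b *+ r *+ z)%MM by rewrite zE mulnC mulmnA.
rewrite EZ Zr etaD //; last by rewrite wdegMn dvdn_mulr.
rewrite eta_muln // -tr -exprM [(r * z)%N]mulnC -zE exprD invfM.
have tZ : t ^+ Z != 0 by rewrite expf_neq0.
have tE : t ^+ E != 0 by rewrite expf_neq0.
by field; rewrite tZ tE.
Qed.

End Point.

(** The ratio c of the values of v and u at b is a (k/g)-th root of unity, and
    v_i / u_i = c^(w_i / g); any g-th root of c works as t. *)
Lemma toric_point_uniq (u v : 'I_n -> K) :
    (forall M, (k %| wdeg w M)%N -> \prod_i u i ^+ M i = \prod_i v i ^+ M i) ->
  exists2 t, t != 0 & forall i, v i = t ^+ w i * u i.
Proof.
move=> H.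
have mapU (x : 'I_n -> K) i j : \prod_l x l ^+ (U_(i) *+ j)%MM l = x i ^+ j.
  rewrite (bigD1 i) //= mulmnE mnm1E eqxx mul1n big1 ?mulr1 // => l ne.
  by rewrite mulmnE mnm1E eq_sym (negbTE ne).
have mapD (x : 'I_n -> K) M M' : \prod_l x l ^+ (M + M')%MM l =
   (\prod_l x l ^+ M l) * (\prod_l x l ^+ M' l).
  by rewrite -big_split; apply: eq_bigr => l _; rewrite mnmDE exprD.
have mapMn (x : 'I_n -> K) M j : \prod_l x l ^+ (M *+ j)%MM l = (\prod_l x l ^+ M l) ^+ j.
  by rewrite -prodrXl; apply: eq_bigr => l _; rewrite mulmnE exprM.
have uv0 i : (u i == 0) = (v i == 0).
  have := H (U_(i) *+ (k %/ w i))%MM; rewrite wdeg_axis dvdnn !mapU => /(_ isT) E.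
  have d0 : (0 < k %/ w i)%N by rewrite divn_gt0 // dvdn_leq.
  have : (u i ^+ (k %/ w i) == 0) = (v i ^+ (k %/ w i) == 0) by rewrite E.
  by rewrite !expf_eq0 d0.
have [b [g [g0 gk gw bs bg]]] := bezout_monomial (fun i => u i != 0).
set ub := \prod_l u l ^+ b l; set vb := \prod_l v l ^+ b l.
have ub0 : ub != 0.
  apply/prodf_neq0 => i _; rewrite expf_eq0 lt0n.
  by apply/negP => /andP[/bs /negbTE ->].
have vb0 : vb != 0.
  apply/prodf_neq0 => i _; rewrite expf_eq0 lt0n.
  by apply/negP => /andP[/bs]; rewrite uv0 => /negbTE ->.
set r := (k %/ g)%N; have kE : k = (r * g)%N by rewrite divnK.
have cr : (vb / ub) ^+ r = 1.
  rewrite expr_div_n -!mapMn H ?mapMn ?divff ?expf_neq0 //.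
  by rewrite wdegMn /dvdn -modnMml bg modnMml mulnC -kE modnn.
have c0 : vb / ub != 0 by rewrite mulf_neq0 ?invr_eq0.
exists (g.-root (vb / ub)); first by rewrite rootC_eq0.
move=> i; have [ui|ui] := eqVneq (u i) 0.
  by rewrite ui mulr0; apply/eqP; rewrite -uv0 ui.
have wig : (w i = g * (w i %/ g))%N by rewrite mulnC divnK ?gw.
rewrite {1}wig exprM rootCK //.
have le : (w i %/ g <= k)%N by rewrite (leq_trans (leq_div _ _)) // dvdn_leq.
have := H (U_(i) *+ 1 + b *+ (k - w i %/ g))%MM.
rewrite wdegD !wdegMn wdeg_mnm1 muln1 /dvdn -modnDmr -modnMml bg modnMml modnDmr.
rewrite mulnBr -wig subnKC; last by rewrite (leq_trans (dvdn_leq k0 (wk i))) // leq_pmull.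
rewrite modnMl => /(_ (eqxx _)); rewrite !mapD !mapU !mapMn !expr1 -/ub -/vb => E.
have ck : (vb / ub) ^+ (w i %/ g) * (vb / ub) ^+ (k - w i %/ g) = 1.
  by rewrite -exprD subnKC // kE exprM cr expr1n.
apply: (mulIf (expf_neq0 (k - w i %/ g) vb0)); rewrite -E.
have -> : vb ^+ (k - w i %/ g) = (vb / ub) ^+ (k - w i %/ g) * ub ^+ (k - w i %/ g).
  by rewrite -exprMn divfK.
by rewrite mulrA [_ * u i]mulrC -[_ * _ * (vb / ub) ^+ _]mulrA ck mulr1.
Qed.

End Toric.

(** * Normality of the Veronese ring *)

Lemma frac_div (D : idomainType) (z : {fraction D}) :
  exists a b : D, b != 0 /\ z = FracField.tofrac a / FracField.tofrac b.
Proof.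
pose x := repr z; exists x.1, x.2.
have d0 : x.2 != 0 by case: (x).
split => //; have b0 : FracField.tofrac x.2 != 0 by rewrite tofrac_eq0.
apply: (mulIf b0); rewrite divfK //; apply/eqP.
rewrite -[z]reprK -/x !piE /FracField.equivf /= !numden_Ratio ?oner_eq0 ?mulf_neq0 //.
by rewrite !mulr1 mulrC.
all: exact: oner_neq0.
Qed.

(** Clearing denominators in an integral equation of a / b. *)
Lemma integrally_closed_by_division (D : idomainType) :
    (forall (a b : D) N (c : 'I_N -> D), b != 0 ->
       a ^+ N = \sum_(i < N) c i * a ^+ i * b ^+ (N - i) -> exists y, a = b * y) ->
  integrally_closed D.
Proof.
move=> H z [p pm /rootP rz]; have [a [b [b0 zE]]] := frac_div z.
have fb0 : FracField.tofrac b != 0 by rewrite tofrac_eq0.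
have sp : size p = (size p).-1.+1 by rewrite prednK // size_poly_gt0 monic_neq0.
have pE : \sum_(i < (size p).-1.+1) p`_i * a ^+ i * b ^+ ((size p).-1 - i) = 0.
  apply/eqP; rewrite -tofrac_eq0 rmorph_sum /=; apply/eqP.
  transitivity ((map_poly (@FracField.tofrac D) p).[z] * FracField.tofrac b ^+ (size p).-1);
    last by rewrite rz mul0r.
  rewrite (@horner_coef_wide _ (size p).-1.+1); last by rewrite -sp size_poly.
  rewrite mulr_suml; apply: eq_bigr => i _.
  rewrite !rmorphM !rmorphXn /= coef_map /= zE -!mulrA; congr (_ * _).
  have -> : FracField.tofrac b ^+ (size p).-1 =
      FracField.tofrac b ^+ i * FracField.tofrac b ^+ ((size p).-1 - i).
    by rewrite -exprD subnKC // -ltnS.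
  by rewrite mulrA -exprMn divfK.
have [y aE] : exists y, a = b * y.
  apply: (H a b (size p).-1 (fun i => - p`_i) b0).
  move: pE; rewrite big_ord_recr /= subnn expr0 mulr1.
  have -> : p`_(size p).-1 = 1 by apply/eqP; rewrite -lead_coefE -monicE.
  rewrite mul1r addrC => /eqP; rewrite addr_eq0 => /eqP ->.
  by rewrite -sumrN; apply: eq_bigr => i _; rewrite !mulNr.
by exists y; rewrite zE aE rmorphM /= mulrC mulKf.
Qed.

(** The sum of the graded pieces of degree divisible by k, as a subring of the
    polynomial ring.  It is closed under the total inverse of the polynomial ring
    because non-units are fixed by it and units are constants. *)
Section VeroneseRing.
Variables (K : fieldType) (n : nat) (w : 'I_n -> nat) (k : nat).
Implicit Types p q : {mpoly K[n]}.

Definition veronese_pred : pred {mpoly K[n]} :=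
  fun p => all (fun M => k %| wdeg w M)%N (msupp p).

Lemma veronese_predP p :
  reflect (forall M, M \in msupp p -> (k %| wdeg w M)%N) (veronese_pred p).
Proof. exact: allP. Qed.

Lemma veronese_predC c : veronese_pred c%:MP.
Proof.
apply/veronese_predP => M; rewrite msuppC; case: eqP => // _.
by rewrite inE => /eqP ->; rewrite wdeg0.
Qed.

Lemma veronese_predM p q : veronese_pred p -> veronese_pred q -> veronese_pred (p * q).
Proof.
move=> /veronese_predP hp /veronese_predP hq; apply/veronese_predP => M /msuppM_le.
by case/allpairsP => -[M1 M2] /= [/hp d1 /hq d2 ->]; rewrite wdegD dvdn_add.
Qed.

Lemma veronese_pred_divring : divring_closed veronese_pred.
Proof.
split=> [|p q hp hq|p q hp hq]; first exact: veronese_predC.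
  apply/veronese_predP => M /msuppB_le; rewrite mem_cat.
  by case/orP => [/(veronese_predP _ hp)|/(veronese_predP _ hq)].
apply: veronese_predM => //; rewrite /GRing.inv /= /mpoly_inv.
by case: ifP => // _; apply: veronese_predC.
Qed.

HB.instance Definition _ :=
  GRing.isDivringClosed.Build {mpoly K[n]} veronese_pred veronese_pred_divring.

Record veronese_ring := VeroneseRing {
  veronese_poly :> {mpoly K[n]}; _ : veronese_pred veronese_poly }.

HB.instance Definition _ := [isSub for veronese_poly].
HB.instance Definition _ := [Choice of veronese_ring by <:].
HB.instance Definition _ := [SubChoice_isSubIntegralDomain of veronese_ring by <:].

End VeroneseRing.

Section VeroneseNormal.
Variables (K : numFieldType) (n : nat) (w : 'I_n -> nat) (k : nat).

(** Let q1 be the part of q in degrees divisible by k.  If q - q1 were not zero, the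
    leading monomial of b (q - q1) = a - b q1 would have degree divisible by k,
    while that of b has and that of q - q1 has not. *)
Lemma veronese_divides (a b q : {mpoly K[n]}) : b != 0 ->
  veronese_pred w k a -> veronese_pred w k b -> a = b * q -> veronese_pred w k q.
Proof.
move=> b0 /veronese_predP ha /veronese_predP hb E.
pose q1 := \sum_(M <- msupp q | (k %| wdeg w M)%N) q@_M *: 'X_[M].
have h1 : veronese_pred w k q1.
  apply/veronese_predP => M /msupp_sum_le.
  case/flattenP => s /mapP[M']; rewrite mem_filter => /andP[dM' _] ->.
  by move=> /msuppZ_le; rewrite msuppX inE => /eqP ->.
suff qE : q = q1 by rewrite qE.
apply/eqP; rewrite -subr_eq0; apply: contraT => d0.
have qd : q - q1 = \sum_(M <- msupp q | ~~ (k %| wdeg w M)%N) q@_M *: 'X_[M].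
  apply/eqP; rewrite subr_eq addrC; apply/eqP.
  by rewrite {1}[q]mpolyE (bigID (fun M => k %| wdeg w M)%N).
have nd M : M \in msupp (q - q1) -> ~~ (k %| wdeg w M)%N.
  rewrite qd => /msupp_sum_le/flattenP[s /mapP[M']];
    rewrite mem_filter => /andP[dM' _] ->.
  by move=> /msuppZ_le; rewrite msuppX inE => /eqP ->.
have : mlead (b * (q - q1)) \in msupp (b * (q - q1)) by rewrite mlead_supp ?mulf_neq0.
rewrite mulrBr -E => h; have dv : (k %| wdeg w (mlead (b * (q - q1))))%N.
  move/msuppB_le: h; rewrite mem_cat mulrBr -E => /orP[/ha //|].
  by apply/veronese_predP/veronese_predM => //; apply/veronese_predP.
have := nd _ (mlead_supp d0); rewrite -(dvdn_addr _ (hb _ (mlead_supp b0))) -wdegD.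
by rewrite -mleadM // dv.
Qed.

Lemma veronese_integrally_closed : integrally_closed (veronese_ring K w k).
Proof.
apply: integrally_closed_by_division => a b N c b0 E.
have vb0 : val b != 0 by apply: contraNneq b0 => vb0; apply/eqP/val_inj.
have [q qE] : exists q, val a = val b * q.
  apply: (@mpoly_dvd_of_integral _ _ _ _ N (val \o c) vb0).
  by rewrite -rmorphXn E rmorph_sum; apply: eq_bigr => i _; rewrite !rmorphM !rmorphXn.
have hq := @veronese_divides (val a) (val b) q vb0 (valP a) (valP b) qE.
by exists (VeroneseRing hq); apply: val_inj.
Qed.

End VeroneseNormal.

(** * The map given by a spanning system of forms of degree k *)

(** The hypotheses isolate what is needed of weights and k.  The G_j span the forms
    of degree k; both the monomials of degree k and the coefficients of
    exponentials of Lie series are such systems. *)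
Section MonomialSystem.
Variables (K : numClosedFieldType) (n N : nat) (w : 'I_n -> nat) (k : nat).
Variable G : N.-tuple {mpoly K[n]}.
Hypotheses (w0 : forall i, (0 < w i)%N) (wk : forall i, (w i %| k)%N) (k0 : (0 < k)%N).
Hypothesis packing : forall (M : 'X_{1..n}) j, wdeg w M = (j.+1 * k)%N ->
  exists M1 M2, M = (M1 + M2)%MM /\ wdeg w M1 = k.
Hypothesis G_homog : forall j, tnth G j \is k.-homog for (wdeg w).
Hypothesis G_span : forall M, wdeg w M = k ->
  exists b : 'I_N -> K, 'X_[M] = \sum_j b j *: tnth G j.

Notation std := (@std_weight N).
Implicit Types (u v : 'rV[K]_n) (q : {mpoly K[N]}) (x : wproj K w).

Definition system_map (v : 'rV[K]_n) : 'rV[K]_N := \row_j (tnth G j).@[v 0].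

Lemma comp_eval (q : {mpoly K[N]}) v : (q \mPo G).@[v 0] = q.@[system_map v 0].
Proof. by rewrite comp_mpoly_meval; apply: meval_eq => j; rewrite mxE. Qed.

Lemma std_homogX (j : 'I_N) : ('X_j : {mpoly K[N]}) \is 1.-homog for (wdeg std).
Proof. by rewrite dhomogX /= wdeg_mnm1. Qed.

Lemma lift_monomial D M : wdeg w M = (D * k)%N ->
  exists2 q : {mpoly K[N]}, q \is D.-homog for (wdeg std) & q \mPo G = 'X_[M].
Proof.
elim: D M => [|D IH] M wM.
  exists 1; first exact: dhomog1.
  by rewrite (wdeg_eq0 w0 wM) mpolyX0 comp_mpoly1.
have [M1 [M2 [ME w1]]] := packing wM.
have [q2 h2 c2] : exists2 q : {mpoly K[N]},
    q \is D.-homog for (wdeg std) & q \mPo G = 'X_[M2].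
  by apply: IH; apply/eqP; rewrite -(eqn_add2l k) -{1}w1 -wdegD -ME wM mulSn.
have [b bE] := G_span w1.
exists ((\sum_j b j *: 'X_j) * q2).
  rewrite -[D.+1]add1n; apply: dhomogM => //; apply: rpred_sum => j _.
  exact/rpredZ/std_homogX.
rewrite rmorphM /= c2 ME mpolyXD bE; congr (_ * _).
rewrite raddf_sum; apply: eq_bigr => j _ /=.
by rewrite comp_mpolyZ comp_mpolyXU -tnth_nth.
Qed.

(** By [packing], products of D monomials of degree k span the forms of degree kD. *)
Lemma lift_homog D (f : {mpoly K[n]}) : f \is (k * D).-homog for (wdeg w) ->
  exists2 q : {mpoly K[N]}, q \is D.-homog for (wdeg std) & q \mPo G = f.
Proof.
move=> /dhomogP hf.
suff [q hq qE] : exists2 q : {mpoly K[N]}, q \is D.-homog for (wdeg std) &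
    q \mPo G = \sum_(M <- msupp f) f@_M *: 'X_[M] by exists q; rewrite // qE -mpolyE.
elim: (msupp f) hf => [|M s IH] hs.
  by exists 0; [exact: dhomog0 | rewrite comp_mpoly0 big_nil].
have [|q hq qE] := IH; first by move=> M' hM'; apply: hs; rewrite inE hM' orbT.
have [|q1 hq1 q1E] := @lift_monomial D M.
  by rewrite mulnC; apply: hs; exact: mem_head.
exists (f@_M *: q1 + q); first by apply: dhomogD => //; apply: rpredZ.
by rewrite comp_mpolyD comp_mpolyZ q1E qE big_cons.
Qed.

(** For v_i != 0 the form X_i^(k / w_i) does not vanish, and it is a combination of
    the G_j. *)
Lemma system_map_neq0 v : v != 0 -> system_map v != 0.
Proof.
apply: contra => /eqP H; apply/eqP/rowP => i; rewrite mxE.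
have [|b /(congr1 (meval (v 0)))] := @G_span (U_(i) *+ (k %/ w i))%MM.
  exact: wdeg_axis.
rewrite raddf_sum /= big1 => [|j _]; last first.
  have := congr1 (fun r : 'rV_N => r 0 j) H; rewrite !mxE => E.
  by rewrite mevalZ E mulr0.
rewrite mevalX (bigD1 i) //= big1 => [|j ne]; last first.
  by rewrite mulmnE mnm1E eq_sym (negbTE ne).
rewrite mulr1 => /eqP; rewrite expf_eq0 => /andP[_ /eqP //].
Qed.

Definition system_proj (x : wproj K w) : wproj K std :=
  wpoint std (system_map_neq0 (hcoord_neq0 x)).

Lemma system_map_scale t (u v : 'rV[K]_n) : (forall i, v 0 i = t ^+ w i * u 0 i) ->
  system_map v = t ^+ k *: system_map u.
Proof. by move=> E; apply/rowP => j; rewrite !mxE (dhomog_scale (G_homog j) E). Qed.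

Lemma system_proj_wpoint v (hv : v != 0) :
  system_proj (wpoint w hv) = wpoint std (system_map_neq0 hv).
Proof.
apply/esym/wpoint_eqP; have [t t0 E] := hcoord_wpoint w hv.
exists (t ^+ k); first by rewrite expf_neq0.
by move=> j; rewrite (system_map_scale E) mxE expr1.
Qed.

Lemma system_proj_eval x : exists2 t, t != 0 &
  forall D (q : {mpoly K[N]}), q \is D.-homog for (wdeg std) ->
    q.@[hcoord (system_proj x) 0] = t ^+ D * (q \mPo G).@[hcoord x 0].
Proof.
have [t t0 E] := hcoord_wpoint std (system_map_neq0 (hcoord_neq0 x)).
by exists t => // D q hq; rewrite (dhomog_scale hq E) comp_eval.
Qed.

Lemma system_proj_eq0 x D (q : {mpoly K[N]}) : q \is D.-homog for (wdeg std) ->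
  q.@[hcoord (system_proj x) 0] = 0 <-> (q \mPo G).@[hcoord x 0] = 0.
Proof.
move=> hq; have [t t0 E] := system_proj_eval x; rewrite (E _ _ hq).
split=> [/eqP|->]; last by rewrite mulr0.
by rewrite mulf_eq0 expf_eq0 (negbTE t0) andbF => /eqP.
Qed.

Lemma homog_eval0 D (p : {mpoly K[n]}) : (0 < D)%N ->
  p \is D.-homog for (wdeg w) -> p.@[(0 : 'rV[K]_n) 0] = 0.
Proof.
move=> D0 hp; have E (i : 'I_n) : (0 : 'rV[K]_n) 0 i = 0 ^+ w i * (0 : 'rV[K]_n) 0 i.
  by rewrite mxE mulr0.
by rewrite (dhomog_scale hp E) expr0n gtn_eqF // mul0r.
Qed.

Lemma system_map0 : system_map 0 = 0.
Proof. by apply/rowP => j; rewrite mxE (homog_eval0 k0 (G_homog j)) mxE. Qed.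

(** Evaluation at y of a lift of a monomial does not depend on the lift, by the
    relations, and is multiplicative: [toric_point] applies. *)
Lemma system_map_image (y : 'rV[K]_N) : y != 0 ->
    (forall D (q : {mpoly K[N]}), q \is D.-homog for (wdeg std) ->
       q \mPo G = 0 -> q.@[y 0] = 0) ->
  exists2 u, u != 0 & system_map u = y.
Proof.
move=> y0 rel.
have wd D (p q : {mpoly K[N]}) : p \is D.-homog for (wdeg std) ->
    q \is D.-homog for (wdeg std) -> p \mPo G = q \mPo G -> p.@[y 0] = q.@[y 0].
  move=> hp hq E; apply/eqP; rewrite -subr_eq0 -mevalB; apply/eqP/(rel D).
    by rewrite rpredB.
  by rewrite rmorphB /= E subrr.
have /choice[Q QP] : forall M, exists q, (k %| wdeg w M)%N ->
    q \is (wdeg w M %/ k).-homog for (wdeg std) /\ q \mPo G = 'X_[M].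
  move=> M; have [dM|nM] := boolP (k %| wdeg w M)%N; last by exists 0.
  have [|q] := @lift_monomial (wdeg w M %/ k) M; first by rewrite divnK.
  by exists q.
pose eta M := (Q M).@[y 0].
have [|M M' dM dM'|u uE] := @toric_point n w k w0 wk k0 K eta.
- have [h0 c0] := QP 0%MM (eq_ind_r (fun e => k %| e)%N (dvdn0 k) (wdeg0 w)).
  rewrite wdeg0 div0n in h0.
  by rewrite /eta (wd 0%N _ 1 h0) ?meval1 //;
    [exact: dhomog1 | rewrite c0 comp_mpoly1 mpolyX0].
- have [h1 c1] := QP M dM; have [h2 c2] := QP M' dM'.
  have [|h3 c3] := QP (M + M')%MM; first by rewrite wdegD dvdn_add.
  rewrite /eta -mevalM; apply: (wd _ _ _ h3).
    by rewrite wdegD divnDl // dhomogM.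
  by rewrite c3 rmorphM /= c1 c2 mpolyXD.
pose v : 'rV[K]_n := \row_i u i.
have vE M : (k %| wdeg w M)%N -> ('X_[M]).@[v 0] = eta M.
  by move=> dM; rewrite uE // mevalX; apply: eq_bigr => i _; rewrite mxE.
have smv : system_map v = y.
  apply/rowP => j; rewrite mxE.
  have /dhomogP hj := G_homog j.
  pose q := \sum_(M <- msupp (tnth G j)) (tnth G j)@_M *: Q M.
  have E : q.@[y 0] = (tnth G j).@[v 0].
    rewrite [tnth G j]mpolyE !raddf_sum /=; apply: eq_big_seq => M /hj hM.
    by rewrite !mevalZ vE // [wdeg w M]hM.
  rewrite -E -[RHS](mevalXU (y 0)); apply: (wd 1%N); last 2 first.
  - exact: std_homogX.
  - rewrite comp_mpolyXU -tnth_nth [RHS]mpolyE raddf_sum /=.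
    apply: eq_big_seq => M /hj hM; rewrite comp_mpolyZ.
    by have [|_ ->] := QP M; rewrite // [wdeg w M]hM.
  rewrite /q big_seq; apply: rpred_sum => M /hj hM; apply: rpredZ.
  have [|h _] := QP M; first by rewrite [wdeg w M]hM.
  by move: h; rewrite [wdeg w M]hM divnn k0.
exists v => //; apply: contraNneq y0 => v0.
by rewrite -smv v0 system_map0.
Qed.

(** After rescaling u by a k-th root of s, all forms of degree divisible by k agree at
    u and v by [lift_homog], and [toric_point_uniq] applies. *)
Lemma system_map_inj u v s : u != 0 -> v != 0 -> s != 0 ->
  system_map v = s *: system_map u -> wscaled w u v.
Proof.
move=> u0 v0 s0 E; set r := k.-root s.
have r0 : r != 0 by rewrite rootC_eq0.
pose u' : 'rV[K]_n := \row_i (r ^+ w i * u 0 i).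
have E' : system_map u' = system_map v.
  by rewrite E (@system_map_scale r u) ?rootCK // => i; rewrite mxE.
have [|t t0 tE] := @toric_point_uniq n w k w0 wk k0 K (u' 0) (v 0).
  move=> M /divnK/esym/lift_monomial[q _ qE].
  by rewrite -!mevalX -qE !comp_eval E'.
exists (t * r); first by rewrite mulf_neq0.
by move=> i; rewrite tE mxE mulrA exprMn.
Qed.

Lemma system_proj_inj : injective system_proj.
Proof.
move=> x x'; rewrite -(wpoint_hcoord (hcoord_neq0 x)) -(wpoint_hcoord (hcoord_neq0 x')).
rewrite !system_proj_wpoint => /wpoint_eqP[s s0 E]; apply/wpoint_eqP.
apply: (@system_map_inj _ _ s) => //; try exact: hcoord_neq0.
by apply/rowP => j; rewrite E expr1 [RHS]mxE.
Qed.

Lemma system_proj_image (y : wproj K std) :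
    (forall D (q : {mpoly K[N]}), q \is D.-homog for (wdeg std) ->
       q \mPo G = 0 -> q.@[hcoord y 0] = 0) ->
  exists x, system_proj x = y.
Proof.
move=> rel; have [u u0 uE] := system_map_image (hcoord_neq0 y) rel.
exists (wpoint w u0); rewrite system_proj_wpoint -[RHS](wpoint_hcoord (hcoord_neq0 y)).
by apply/wpoint_eqP; exists 1 => [|i]; rewrite ?oner_neq0 // expr1n mul1r uE.
Qed.

Lemma system_proj_preimage (B : set (wproj K std)) : zariski_closed B ->
  zariski_closed (system_proj @^-1` B).
Proof.
move=> [S [hS ->]]; exists [set p | exists2 q, S q & p = q \mPo G]; split.
  by move=> _ [q /hS[D hq] ->]; exists (k * D)%N; apply: dhomog_comp.
apply/seteqP; split=> x /= h.
  by move=> _ [q Sq ->]; have [D hq] := hS q Sq; apply/(system_proj_eq0 x hq)/h.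
move=> q Sq; have [D hq] := hS q Sq; apply/(system_proj_eq0 x hq).
by apply: h; exists q.
Qed.

(** The image is cut out by the forms q whose pull-back vanishes on A: at a point x
    outside A some p defining A is not zero, and p^k is the pull-back of a form. *)
Lemma system_proj_closed (A : set (wproj K w)) : zariski_closed A ->
  zariski_closed (system_proj @` A).
Proof.
move=> [S [hS AE]].
exists [set q | (exists D, q \is D.-homog for (wdeg std)) /\
   forall x, A x -> (q \mPo G).@[hcoord x 0] = 0]; split; first by move=> q [].
apply/seteqP; split=> [_ [x Ax <-] q [[D hq] hA]|y /= hy].
  exact/(system_proj_eq0 x hq)/hA.
have [D q hq q0|x xy] := @system_proj_image y.
  by apply: hy; split=> [|x _]; [exists D | rewrite q0 meval0].
exists x; rewrite // AE => p Sp; have [D hp] := hS p Sp.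
have [|q hq qE] := @lift_homog D (p ^+ k); first by rewrite mulnC; apply: dhomogMn.
have /(system_proj_eq0 x hq) : q.@[hcoord (system_proj x) 0] = 0.
  rewrite xy; apply: hy; split=> [|x']; first by exists D.
  by rewrite AE => /(_ p Sp) x'0; rewrite qE rmorphXn /= x'0 expr0n gtn_eqF.
by rewrite qE rmorphXn /= => /eqP; rewrite expf_eq0 => /andP[_ /eqP].
Qed.

Lemma system_proj_regular (U : set (wproj K std)) f : regular_on U f ->
  regular_on (system_proj @^-1` U) (f \o system_proj).
Proof.
move=> reg x /reg[V [oV Vx [D [g [h [hg hh E]]]]]].
exists (system_proj @^-1` V); split => //; first exact: system_proj_preimage oV.
exists (k * D)%N, (g \mPo G), (h \mPo G); split; try exact: dhomog_comp.
move=> y Vy Uy; have [] := E _ Vy Uy; have [t t0 tE] := system_proj_eval y.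
rewrite /= (tE _ _ hg) (tE _ _ hh) mulf_eq0 => /norP[tD hy] ->; split => //.
by rewrite -mulf_div divff // mul1r.
Qed.

Lemma system_proj_morphism : is_morphism [set: wproj K w] (range system_proj) system_proj.
Proof.
split=> [x _|B /system_proj_preimage cB|V f oV reg]; first by exists x.
  by exists (system_proj @^-1` B).
move=> x [_ Vx]; have [|W [oW Wx [D [g [h [hg hh E]]]]]] := system_proj_regular reg (x := x).
  by split => //; exists x.
exists W; split => //; exists D, g, h; split => // y Wy [_ Vy].
by apply: E => //; split => //; exists y.
Qed.

Definition system_inv (x0 : wproj K w) (y : wproj K std) : wproj K w :=
  xget x0 [set x | system_proj x = y].

Lemma system_projK x0 : cancel system_proj (system_inv x0).
Proof.
move=> x; apply: system_proj_inj.
by apply: (@xgetPex _ x0 [set x' | system_proj x' = system_proj x]); exists x.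
Qed.

(** Near x, f = g / h = g h^(k-1) / h^k, and both terms are pull-backs.  The image of
    an open set is open in the image because the map is closed and injective. *)
Lemma system_inv_regular x0 (V : set (wproj K w)) f : regular_on V f ->
  regular_on (range system_proj `&` system_inv x0 @^-1` V) (f \o system_inv x0).
Proof.
move=> reg _ [[x _ <-]]; rewrite /= system_projK => Vx.
have [W [oW Wx [D [g [h [hg hh E]]]]]] := reg x Vx.
have [|g' hg' gE] := @lift_homog D (g * h ^+ k.-1).
  by rewrite -(prednK k0) mulSn [(_ * D)%N]mulnC; apply: dhomogM => //; apply: dhomogMn.
have [|h' hh' hE] := @lift_homog D (h ^+ k); first by rewrite mulnC; apply: dhomogMn.
exists (~` (system_proj @` ~` W)); split.
- by rewrite /zariski_open setCK; apply: system_proj_closed.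
- by move=> [x' nW /system_proj_inj xx']; apply: nW; rewrite xx'.
exists D, g', h'; split => // y nWy [[x' _ x'y]]; rewrite -{}x'y in nWy *.
rewrite /= system_projK => Vx'.
have Wx' : W x' by apply: contrapT => nW; apply: nWy; exists x'.
have [hx' ->] := E x' Wx' Vx'; have [t t0 tE] := system_proj_eval x'.
rewrite (tE _ _ hg') (tE _ _ hh') gE hE rmorphM !rmorphXn /=.
rewrite mulf_neq0 ?expf_neq0 //; split => //.
rewrite -mulf_div divff ?expf_neq0 // mul1r -{2}(prednK k0) exprS invfM.
by field; rewrite hx' expf_neq0.
Qed.

Lemma system_inv_morphism x0 :
  is_morphism (range system_proj) [set: wproj K w] (system_inv x0).
Proof.
split=> // [B cB|V f oV reg].
  exists (system_proj @` B); first exact: system_proj_closed.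
  apply/seteqP; split=> [_ [[x _ <-]]|_ [_ [x Bx <-]]].
    by rewrite /= system_projK => Bx; split; exists x.
  by split; [exists x | rewrite /= system_projK].
by rewrite setTI in reg; apply: system_inv_regular.
Qed.

Hypothesis n0 : (0 < n)%N.

Lemma wproj_point : exists x : wproj K w, True.
Proof.
have v0 : const_mx 1 != 0 :> 'rV[K]_n.
  by apply/eqP => /rowP/(_ (Ordinal n0))/eqP; rewrite !mxE oner_eq0.
by exists (wpoint w v0).
Qed.

Lemma system_proj_closed_immersion : closed_immersion [set: wproj K w] system_proj.
Proof.
have [x0 _] := wproj_point; split.
  apply: system_proj_closed; exists set0; split=> [p []|].
  by apply/seteqP; split=> // x _ p [].
split; first exact: system_proj_morphism.
exists (system_inv x0); split; first exact: system_inv_morphism.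
  by move=> x _; apply: system_projK.
by move=> _ [x _ <-]; rewrite system_projK.
Qed.

Lemma system_image_isomorphic : isomorphic (range system_proj) [set: wproj K w].
Proof.
have [x0 _] := wproj_point; exists (system_inv x0).
split; first exact: system_inv_morphism.
exists system_proj; split; first exact: system_proj_morphism.
  by move=> _ [x _ <-]; rewrite system_projK.
by move=> x _; apply: system_projK.
Qed.

(** Multiplication by t in the target is the action of a k-th root of t in the source. *)
Lemma affine_cone_system : affine_cone (range system_proj) = range system_map.
Proof.
apply/seteqP; split=> v /= h; last first.
  move=> hv; have [u _ uE] := h; have u0 : u != 0.
    by apply: contraNneq hv => u0; rewrite -uE u0 system_map0.
  exists (wpoint w u0) => //; rewrite system_proj_wpoint.
  by apply/wpoint_eqP; exists 1 => [|i]; rewrite ?oner_neq0 // expr1n mul1r uE.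
have [v0|hv] := eqVneq v 0; first by exists 0; rewrite // system_map0 v0.
have [x _] := h hv; rewrite -(wpoint_hcoord (hcoord_neq0 x)) system_proj_wpoint.
move=> /wpoint_eqP[t t0 tE].
pose u : 'rV[K]_n := \row_i ((k.-root t) ^+ w i * hcoord x 0 i).
exists u => //; rewrite (@system_map_scale (k.-root t) (hcoord x)); last by move=> i;
  rewrite mxE.
by apply/rowP => j; rewrite rootCK // mxE tE expr1.
Qed.

Lemma veronese_comp q : veronese_pred w k (q \mPo G).
Proof.
rewrite [q]mpolyE raddf_sum /=; elim: (msupp q) => [|M s IH].
  by rewrite big_nil -mpolyC0 veronese_predC.
rewrite big_cons comp_mpolyZ; apply: rpredD IH; rewrite -mul_mpolyC.
apply: veronese_predM; first exact: veronese_predC.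
have hM : ('X_[M] : {mpoly K[N]}) \is (mdeg M).-homog for (wdeg std).
  by rewrite dhomogX /= wdeg_std.
by apply/veronese_predP => M' /(dhomog_mf (dhomog_comp G_homog hM)) /= ->;
  rewrite dvdn_mulr.
Qed.

Definition veronese_pres q : veronese_ring K w k := VeroneseRing (veronese_comp q).

Lemma veronese_pres_zmod : zmod_morphism veronese_pres.
Proof. by move=> p q; apply: val_inj; rewrite /= rmorphB. Qed.

Lemma veronese_pres_monoid : monoid_morphism veronese_pres.
Proof. by split=> [|p q]; apply: val_inj; rewrite /= ?rmorph1 ?rmorphM. Qed.

HB.instance Definition _ :=
  GRing.isZmodMorphism.Build {mpoly K[N]} (veronese_ring K w k) veronese_pres veronese_pres_zmod.
HB.instance Definition _ :=
  GRing.isMonoidMorphism.Build {mpoly K[N]} (veronese_ring K w k) veronese_pres veronese_pres_monoid.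

Lemma system_image_projectively_normal : projectively_normal (range system_proj).
Proof.
exists (veronese_ring K w k), veronese_pres; split;
  last exact: veronese_integrally_closed.
- move=> [f hf]; suff [q qE] : exists q, q \mPo G = f by exists q; apply: val_inj.
  rewrite [f]mpolyE; elim: (msupp f) (veronese_predP _ _ _ hf) => [|M s IH] hs.
    by exists 0; rewrite comp_mpoly0 big_nil.
  have [|q qE] := IH; first by move=> M' hM'; apply: hs; rewrite inE hM' orbT.
  have /divnK/esym/lift_monomial[q1 _ q1E] := hs M (mem_head _ _).
  by exists (f@_M *: q1 + q); rewrite comp_mpolyD comp_mpolyZ q1E qE big_cons.
- move=> q; rewrite affine_cone_system; split=> [/(congr1 val) /= q0 _ [u _ <-]|h].
    by rewrite -comp_eval q0 meval0.
  apply: val_inj; apply: mpoly_eq_eval => v /=.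
  by rewrite comp_eval meval0; apply: h; exists v.
Qed.

End MonomialSystem.

(** * Weights that do not divide k *)

Section NonEmbedding.
Variables (K : numFieldType) (n : nat) (w : 'I_n -> nat) (k : nat).
Notation N := #|{: wmonomial w k}|.
Implicit Types (v : 'rV[K]_n).

Definition wmonomial_nth (j : 'I_N) : 'X_{1..n} := val (enum_val j).

Lemma wdeg_wmonomial_nth j : wdeg w (wmonomial_nth j) = k.
Proof. exact/eqP/(valP (enum_val j)). Qed.

Lemma wmonomial_nth_surj M : wdeg w M = k -> (mdeg M <= k)%N ->
  exists j, wmonomial_nth j = M.
Proof.
move=> wM dM; have hw : wdeg w (BMultinom (dM : (mdeg M < k.+1)%N)) == k by apply/eqP.
pose x : wmonomial w k := exist (fun m : 'X_{1..n < k.+1} => wdeg w m == k) _ hw.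
by exists (enum_rank x); rewrite /wmonomial_nth enum_rankK.
Qed.

Lemma wmonomial_mapE v j : wmonomial_map w k v 0 j = \prod_i v 0 i ^+ wmonomial_nth j i.
Proof. by rewrite mxE mevalX. Qed.

Lemma poly_eq0_off0 (p : {poly K}) : (forall s, s != 0 -> p.[s] = 0) -> p = 0.
Proof.
move=> H; have : p * 'X = 0.
  apply/eqP; apply: contraT => /poly_nat_nonroot[a].
  rewrite hornerM hornerX; have [->|/H ->] := eqVneq (a%:R : K) 0.
    by rewrite mulr0 eqxx.
  by rewrite mul0r eqxx.
by move/eqP; rewrite mulf_eq0 polyX_eq0 orbF => /eqP.
Qed.

(** For each coordinate j there is a variable l other than z in the monomial j, and a
    variable a of weight 1 other than l.  Along the line s e_a + e_z with s != 0
    the map is defined, because of the monomial X_a^k, and the coordinate j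
    vanishes; by continuity it vanishes at s = 0. *)
Lemma no_embedding (x y z : 'I_n) : x != y -> w x = 1%N -> w y = 1%N ->
    ~~ (w z %| k)%N ->
  ~ rational_map_embedding w (@std_weight _) (@wmonomial_map K _ w k).
Proof.
move=> xy wx wy nz [phi [phiE [_ [[_ cont _] _]]]].
have ez0 : delta_mx 0 z != 0 :> 'rV[K]_n.
  by apply/eqP => /rowP/(_ z)/eqP; rewrite !mxE !eqxx oner_eq0.
set E := wpoint w ez0.
suff Q0 : hcoord (phi E) = 0 by have := hcoord_neq0 (phi E); rewrite Q0 eqxx.
apply/rowP => j; rewrite mxE.
set M := wmonomial_nth j; have wM : wdeg w M = k := wdeg_wmonomial_nth j.
have [l lz Ml] : exists2 l, l != z & M l != 0%N.
  apply: contrapT => H; case/negP: nz; rewrite -wM.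
  rewrite /wdeg (bigD1 z) //= big1 ?addn0 ?dvdn_mulr // => l lz.
  by case: (eqVneq (M l) 0%N) => [->|Ml]; [rewrite muln0 | case: H; exists l].
have [a [al wa]] : exists a, a != l /\ w a = 1%N.
  by have [<-|xl] := eqVneq x l; [exists y; rewrite eq_sym | exists x].
have az : a != z by apply: contraNneq nz => <-; rewrite wa dvd1n.
(* a parametrization of the line through the coordinate points a and z *)
pose p s : 'rV[K]_n := s *: delta_mx 0 a + delta_mx 0 z.
have pz s : p s != 0.
  apply/eqP => /rowP/(_ z)/eqP; rewrite !mxE !eqxx (eq_sym z) (negbTE az) mulr0 add0r.
  by rewrite oner_eq0.
have pl s : p s 0 l = 0.
  by rewrite !mxE eqxx /= (eq_sym l) (negbTE al) (negbTE lz) mulr0 addr0.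
have pa s : p s 0 a = s by rewrite !mxE !eqxx (negbTE az) mulr1 addr0.
have p0 : p 0 = delta_mx 0 z by rewrite /p scale0r add0r.
have hX i : ('X_i : {mpoly K[N]}) \is 1.-homog for (wdeg (@std_weight N)).
  by rewrite dhomogX /= wdeg_mnm1.
have [|A cA /seteqP[AE EA]] := cont [set x | ('X_j : {mpoly K[N]}).@[hcoord x 0] = 0].
  exists [set 'X_j]; split; first by move=> _ ->; exists 1%N.
  by apply/seteqP; split=> [u /= h q ->|u /= h]; last exact: h.
have curve s : s != 0 -> A (wpoint w (pz s)).
  move=> s0; suff /AE[] : (setT `&` phi @^-1` [set x | ('X_j : {mpoly K[N]}).@[hcoord x 0] = 0])
    (wpoint w (pz s)) by [].
  split=> //=; have [t t0 tE] := hcoord_wpoint w (pz s).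
  have FE i : wmonomial_map w k (hcoord (wpoint w (pz s))) 0 i = t ^+ k * wmonomial_map w k (p s) 0 i.
    rewrite !mxE; apply: (dhomog_scale _ tE); rewrite dhomogX /=.
    by apply/eqP/wdeg_wmonomial_nth.
  have hF : wmonomial_map w k (hcoord (wpoint w (pz s))) != 0.
    have [||i iE] := @wmonomial_nth_surj (U_(a) *+ k)%MM.
    - by rewrite wdegMn wdeg_mnm1 wa mul1n.
    - by rewrite mdegMn mdeg1 mul1n.
    apply/eqP => /rowP/(_ i)/eqP; rewrite FE wmonomial_mapE iE mxE mulf_eq0.
    rewrite (bigD1 a) //= big1 => [|b ba];
      last by rewrite mulmnE mnm1E eq_sym (negbTE ba).
    by rewrite mulmnE mnm1E eqxx mul1n mulr1 pa !expf_eq0 (negbTE s0) (negbTE t0) !andbF.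
  rewrite (phiE _ hF); apply/(dhomog_hcoord_eq0 _ (hX j)).
  rewrite mevalXU FE wmonomial_mapE (bigD1 l) //= pl expr0n (negbTE Ml) mul0r.
  by rewrite mulr0.
have AEz : A E.
  case: cA curve {AE EA} => S [hS ->] curve /= f Sf; have [D hf] := hS f Sf.
  apply/(dhomog_hcoord_eq0 ez0 hf).
  pose kappa i : {poly K} := ((i == a)%:R)%:P * 'X + ((i == z)%:R)%:P.
  have kE s : (mmap polyC kappa f).[s] = f.@[p s 0].
    rewrite horner_mmap; apply: meval_eq => i.
    by rewrite hornerD hornerM !hornerC hornerX !mxE eqxx /= mulrC.
  have P0 : mmap polyC kappa f = 0.
    apply: poly_eq0_off0 => s s0; rewrite kE.
    exact/(dhomog_hcoord_eq0 (pz s) hf)/curve.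
  by have := kE 0; rewrite P0 horner0 p0.
by have [_ /=] := EA E (conj I AEz); rewrite mevalXU.
Qed.

End NonEmbedding.

(** * Shuffles of words and Lyndon words *)

Section Shuffles.
Variable T : eqType.
Implicit Types (a b : T) (u v x y p s t : seq T).

(** With multiplicities, so that summing over this list is the shuffle product. *)
Fixpoint shuffles u : seq T -> seq (seq T) :=
  if u is a :: u' then
    fix sh v := if v is b :: v' then
      [seq a :: t | t <- shuffles u' v] ++ [seq b :: t | t <- sh v'] else [:: u]
  else fun v => [:: v].

Lemma shuffles0s v : shuffles [::] v = [:: v]. Proof. by []. Qed.

Lemma shuffless0 u : shuffles u [::] = [:: u]. Proof. by case: u. Qed.

Lemma shuffles_cons a u b v : shuffles (a :: u) (b :: v) =
  [seq a :: t | t <- shuffles u (b :: v)] ++ [seq b :: t | t <- shuffles (a :: u) v].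
Proof. by []. Qed.

Lemma mem_shuffles_consl a u v t : t \in shuffles u v -> a :: t \in shuffles (a :: u) v.
Proof.
case: v => [|b v] h; last by rewrite shuffles_cons mem_cat map_f.
by move: h; rewrite !shuffless0 !inE => /eqP ->.
Qed.

Lemma mem_shuffles_consr b u v t : t \in shuffles u v -> b :: t \in shuffles u (b :: v).
Proof.
case: u => [|a u] h; last by rewrite shuffles_cons mem_cat (map_f _ h) orbT.
by move: h; rewrite !shuffles0s !inE => /eqP ->.
Qed.

Lemma shuffles_ind (P : seq T -> seq T -> seq T -> Prop) :
    P [::] [::] [::] ->
    (forall a u v t, t \in shuffles u v -> P u v t -> P (a :: u) v (a :: t)) ->
    (forall b u v t, t \in shuffles u v -> P u v t -> P u (b :: v) (b :: t)) ->
  forall u v t, t \in shuffles u v -> P u v t.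
Proof.
move=> P0 Pl Pr; elim=> [|a u IHu] v.
  elim: v => [|b v IHv] t; rewrite shuffles0s inE => /eqP -> //.
  by apply: Pr; [|apply: IHv]; rewrite shuffles0s inE.
elim: v => [|b v IHv] t.
  rewrite shuffless0 inE => /eqP ->.
  by apply: Pl; [|apply: IHu]; rewrite shuffless0 inE.
rewrite shuffles_cons mem_cat => /orP[] /mapP[t' ht ->].
  by apply: Pl => //; apply: IHu.
by apply: Pr => //; apply: IHv.
Qed.

Lemma shuffles_sym u v t : t \in shuffles u v -> t \in shuffles v u.
Proof.
move: u v t; apply: shuffles_ind => // *; first exact: mem_shuffles_consr.
exact: mem_shuffles_consl.
Qed.

Lemma size_shuffles u v t : t \in shuffles u v -> size t = (size u + size v)%N.
Proof.
by move: u v t; apply: shuffles_ind => //= a u v t _ ->; rewrite ?addSn ?addnS.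
Qed.

Lemma mem_shuffles_cat u1 v1 t1 u2 v2 t2 :
    t1 \in shuffles u1 v1 -> t2 \in shuffles u2 v2 ->
  t1 ++ t2 \in shuffles (u1 ++ u2) (v1 ++ v2).
Proof.
move=> h1 h2; move: u1 v1 t1 h1; apply: shuffles_ind => //= *.
  exact: mem_shuffles_consl.
exact: mem_shuffles_consr.
Qed.

Lemma cat_mem_shuffles u v : u ++ v \in shuffles u v.
Proof.
have := @mem_shuffles_cat u [::] u [::] v v; rewrite cats0; apply.
  by rewrite shuffless0 inE.
by rewrite shuffles0s inE.
Qed.

Lemma shuffles_split_catl x y t : t \in shuffles x y ->
  forall p x', x = p ++ x' -> exists y1 y2 s r,
   [/\ y = y1 ++ y2, t = s ++ r, s \in shuffles p y1 & r \in shuffles x' y2].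
Proof.
move: x y t; apply: shuffles_ind => [|a u v t ht IH|b u v t ht IH] p x'.
- by case: p => //= <-; exists [::], [::], [::], [::].
- case: p => [|c p] /= E.
    by rewrite -E; exists [::], v, [::], (a :: t); split=> //; apply: mem_shuffles_consl.
  case: E => E1 E2; have [y1 [y2 [s [r [-> -> hs hr]]]]] := IH _ _ E2.
  by exists y1, y2, (a :: s), r; rewrite E1; split=> //; rewrite -E1;
    apply: mem_shuffles_consl.
move=> E; have [y1 [y2 [s [r [-> -> hs hr]]]]] := IH _ _ E.
by exists (b :: y1), y2, (b :: s), r; split=> //; apply: mem_shuffles_consr.
Qed.

Lemma shuffles_split_letter u x t : t \in shuffles u x ->
  forall c a y, x = c ++ a :: y -> exists u1 u2 s r,
   [/\ u = u1 ++ u2, t = s ++ a :: r, s \in shuffles u1 c & r \in shuffles u2 y].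
Proof.
move: u x t; apply: shuffles_ind => [|b u v t ht IH|b u v t ht IH] c a y.
- by case: c.
- move=> E; have [u1 [u2 [s [r [-> -> hs hr]]]]] := IH _ _ _ E.
  by exists (b :: u1), u2, (b :: s), r; split=> //; apply: mem_shuffles_consl.
case: c => [|c0 c] /= [<- E]; first by exists [::], u, [::], t; rewrite -E.
have [u1 [u2 [s [r [-> -> hs hr]]]]] := IH _ _ _ E.
by exists u1, u2, (b :: s), r; split=> //; apply: mem_shuffles_consr.
Qed.

End Shuffles.

Section Lexicographic.
Variables (disp : Order.disp_t) (T : orderType disp).
Implicit Types (a b : T) (u v x y p s t c : seq T).

Notation "u <=l v" := (@Order.le _ (seqlexi T) u v) (at level 70).
Notation "u <l v" := (@Order.lt _ (seqlexi T) u v) (at level 70).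

Lemma lexi_cat c x y : (c ++ x <=l c ++ y) = (x <=l y).
Proof. by elim: c => //= a c <-; rewrite eqhead_lexiE. Qed.

Lemma ltxi_cat c x y : (c ++ x <l c ++ y) = (x <l y).
Proof. by elim: c => //= a c <-; rewrite eqhead_ltxiE. Qed.

Lemma lexi_prefix s t : s <=l s ++ t.
Proof. by rewrite -{1}[s]cats0 lexi_cat. Qed.

Lemma ltxi_branch c a b x y : (a < b)%O -> c ++ a :: x <l c ++ b :: y.
Proof. by move=> ab; rewrite ltxi_cat ltxi_cons (ltW ab) leNgt ab. Qed.

Lemma lexi_cases s t : s <=l t -> (exists t2, t = s ++ t2) \/
  (exists c a b s' t', [/\ s = c ++ a :: s', t = c ++ b :: t' & (a < b)%O]).
Proof.
elim: s t => [|a s IH] t; first by left; exists t.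
case: t => [|b t]; first by rewrite lexis0.
rewrite lexi_cons => /andP[]; rewrite le_eqVlt => /predU1P[<-|ab _]; last first.
  by right; exists [::], a, b, s, t.
rewrite lexx /= => /IH[[t2 ->]|[c [a' [b' [s' [t' [-> -> ab]]]]]]].
  by left; exists t2.
by right; exists (a :: c), a', b', s', t'.
Qed.

Lemma lexi_prefix_of s t x y : s <l t -> t ++ x <=l s ++ y ->
  exists2 t2, t2 != [::] & t = s ++ t2.
Proof.
move=> st le; case: (lexi_cases (ltW st)) => [[t2 E]|[c [a [b [s' [t' [sE tE ab]]]]]]].
  by exists t2 => //; apply: contraTneq st => t20; rewrite E t20 cats0 ltxx.
by move: le; rewrite sE tE -!catA leNgt ltxi_branch.
Qed.

(** Moving a common prefix p from the larger word x to the smaller word y does not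
    decrease the largest shuffle.  A shuffle t of px and y begins with a shuffle of
    p and a prefix y1 of y.  If x = y1 x2 too, the roles of p and y1 are exchanged
    and the remaining words are shorter.  If not, x exceeds y1 at some letter, and
    taking that letter from x instead of y gives a larger word. *)
Lemma shuffle_exchange p x y t : y <=l x -> t \in shuffles (p ++ x) y ->
  exists2 t', t' \in shuffles x (p ++ y) & t <=l t'.
Proof.
have [m le_m] := ubnP (size p + size x + size y)%N.
elim: m p x y t le_m => // m IH [|p0 p] x y t le_m yx ht; first by exists t;
  rewrite // lexx.
have [y1 [y2 [s [r [yE tE hs hr]]]]] := shuffles_split_catl ht (erefl _).
have : y1 <=l x by apply: le_trans yx; rewrite yE lexi_prefix.
case/lexi_cases => [[x2 xE]|[c [a [b [s' [x' [y1E xE ab]]]]]]].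
  have yx2 : y2 <=l x2 by move: yx; rewrite yE xE lexi_cat.
  have [||r' hr' rr'] := IH y1 x2 y2 r _ yx2.
  - by move: le_m; rewrite yE xE /= !size_cat; lia.
  - by rewrite -xE.
  exists (s ++ r'); last by rewrite tE lexi_cat.
  by rewrite xE yE; apply: mem_shuffles_cat => //; apply: shuffles_sym.
have [p1 [p2 [s1 [s2 [pE sE hs1 hs2]]]]] := shuffles_split_letter hs y1E.
(* b is larger than the letter a of y1 that follows s1 in t *)
exists (s1 ++ b :: (x' ++ (p2 ++ y))).
  rewrite pE xE -catA; apply: mem_shuffles_cat; first exact: shuffles_sym.
  exact: (cat_mem_shuffles (b :: x')).
by rewrite tE sE -catA; apply/ltW/ltxi_branch.
Qed.

(** Merging greedily from the larger remaining word, which by assumption is always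
    that of u, is optimal by [shuffle_exchange] with a one-letter prefix. *)
Lemma shuffles_le_cat u v t : (forall p s, u = p ++ s -> s != [::] -> v <=l s) ->
  t \in shuffles u v -> t <=l u ++ v.
Proof.
elim: u v t => [|a u IH] v t hu; first by rewrite shuffles0s inE => /eqP ->; exact: lexx.
have IH' t' : t' \in shuffles u v -> t' <=l u ++ v.
  by apply: IH => p s E; apply: (hu (a :: p)); rewrite E.
case: v hu {IH} IH' => [|b v] hu IH.
  by rewrite shuffless0 inE cats0 => /eqP ->; exact: lexx.
rewrite shuffles_cons mem_cat => /orP[] /mapP[t' ht ->];
  first by rewrite /= eqhead_lexiE IH.
have /= := hu [::] _ (erefl _) isT; rewrite lexi_cons => /andP[].
rewrite le_eqVlt => /predU1P[ba|ba _]; last by rewrite /= lexi_cons (ltW ba) leNgt ba.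
subst b; rewrite lexx /= => vu; rewrite eqhead_lexiE.
have [t'' ht'' /le_trans] := @shuffle_exchange [:: a] u v t' vu ht.
by apply; apply: IH.
Qed.

Lemma min_suffix (Q : pred nat) w : (exists2 j, (j <= size w)%N & Q j) ->
  exists j, [/\ (j <= size w)%N, Q j &
    forall i, (i <= size w)%N -> Q i -> drop j w <=l drop i w].
Proof.
move=> [j0 j0w Qj0]; pose P (j : 'I_(size w).+1) := Q j.
have Pj0 : P (Ordinal (j0w : (j0 < (size w).+1)%N)) by [].
have [j Pj jmin] := @arg_minP _ (seqlexi T) _ _ P (fun j => drop j w : seqlexi T) Pj0.
exists j; split=> // [|i iw Qi]; first by rewrite -ltnS.
exact: (jmin (Ordinal (iw : (i < (size w).+1)%N))).
Qed.

End Lexicographic.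

Section Lyndon.
Variable d : nat.
Implicit Types u v w s t : seq 'I_d.

Notation "u <=l v" := (@Order.le _ (seqlexi 'I_d) u v) (at level 70).
Notation "u <l v" := (@Order.lt _ (seqlexi 'I_d) u v) (at level 70).

Lemma lyndonP w : reflect (w != [::] /\
    forall j, (0 < j < size w)%N -> w <l drop j w) (lyndon w).
Proof.
apply: (iffP andP) => [[w0 /forallP h]|[w0 h]]; split=> //.
  by move=> j /andP[j0 jw]; apply: (implyP (h (Ordinal jw))).
by apply/forallP => j; apply/implyP => j0; apply: h; rewrite j0 ltn_ord.
Qed.

Lemma lyndon_suffix u v : lyndon (u ++ v) -> u != [::] -> v != [::] -> u ++ v <l v.
Proof.
move=> /lyndonP[_ h] u0 v0; rewrite -{2}(drop_size_cat v (erefl (size u))).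
by apply: h; rewrite size_cat -{2}[size u]addn0 ltn_add2l !lt0n !size_eq0 u0.
Qed.

Lemma lyndonI w : w != [::] ->
  (forall u v, u != [::] -> v != [::] -> w = u ++ v -> w <l v) -> lyndon w.
Proof.
move=> w0 h; apply/lyndonP; split=> // j /andP[j0 jw].
apply: (h (take j w)); last by rewrite cat_take_drop.
  by rewrite -size_eq0 size_takel -?lt0n // ltnW.
by rewrite -size_eq0 size_drop -lt0n subn_gt0.
Qed.

Lemma cat_neq0l u v : u != [::] -> u ++ v != [::].
Proof. by case: u. Qed.

Lemma cat_neq_suffix u v : u != [::] -> v <> u ++ v.
Proof. by move=> u0 /(congr1 size) /eqP;
  rewrite size_cat -{1}[size v]add0n eqn_add2r eq_sym size_eq0 (negbTE u0). Qed.

Lemma min_suffix_split (Q : pred nat) w : (forall j, Q j -> (j < size w)%N) ->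
  (exists j, Q j) ->
  exists u v, [/\ w = u ++ v, Q (size u), v != [::] &
    forall s t, w = s ++ t -> Q (size s) -> v <=l t].
Proof.
move=> Qw [j0 Qj0]; have [|j [jw Qj jmin]] := @min_suffix _ _ Q w.
  by exists j0; rewrite // ltnW ?Qw.
have sj : size (take j w) = j by rewrite size_takel.
exists (take j w), (drop j w); split; rewrite ?cat_take_drop ?sj //.
  by rewrite -size_eq0 size_drop -lt0n subn_gt0 Qw.
move=> s t E Qs; rewrite -(drop_size_cat t (erefl (size s))) -E.
by apply: jmin => //; rewrite ltnW ?Qw.
Qed.

(** The right factor is the smallest proper suffix. *)
Lemma lyndon_factor w : lyndon w -> (1 < size w)%N -> exists u v,
  [/\ w = u ++ v, lyndon u, lyndon v & w <l v ++ u].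
Proof.
move=> lw w1.
have [|| u [v [wE /andP[u0 _] v0 vmin]]] := @min_suffix_split (fun j => 0 < j < size w)%N w.
- by move=> j /andP[].
- by exists 1%N.
rewrite lt0n size_eq0 in u0.
have vmin' s t : s != [::] -> t != [::] -> w = s ++ t -> v <=l t.
  move=> s0 t0 E; apply: (vmin _ _ E); rewrite E size_cat -{2}[size s]addn0 ltn_add2l.
  by rewrite !lt0n !size_eq0 s0.
exists u, v; split=> //; last first.
  by rewrite wE; apply: lt_le_trans (lexi_prefix _ _); apply: lyndon_suffix; rewrite -?wE.
  apply: lyndonI => // s t s0 t0 vE; rewrite lt_neqAle; apply/andP; split.
    by rewrite vE eq_sym; apply/eqP/cat_neq_suffix.
  by apply: (vmin' (u ++ s)); rewrite ?cat_neq0l // -catA -vE.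
apply: lyndonI => // s t s0 t0 uE; rewrite ltNge; apply/negP => tu.
have lt_tu : t <l u.
  by rewrite lt_neqAle tu andbT; apply/eqP; rewrite uE; apply: cat_neq_suffix.
have lt_w : u ++ v <l t ++ v.
  by have := @lyndon_suffix s (t ++ v); rewrite catA -uE -wE; apply; rewrite ?cat_neq0l.
have [u2 u20 uE2] := lexi_prefix_of lt_tu (ltW lt_w).
move: lt_w; rewrite {1}uE2 -catA ltxi_cat ltNge => /negP; apply.
by apply: (vmin' t); rewrite ?cat_neq0l // catA -uE2.
Qed.

(** With v the smallest suffix of w, every suffix s of u satisfies v <= s: otherwise
    s is a proper prefix of v, and the rest of v is a smaller suffix of w. *)
Lemma nonlyndon_factor w : w != [::] -> ~~ lyndon w -> exists u v,
  [/\ w = u ++ v, u != [::], v != [::] & forall t, t \in shuffles u v -> t <=l w].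
Proof.
move=> w0 nl.
have [|| u [v [wE _ v0 vmin]]] := @min_suffix_split (fun j => j < size w)%N w => //.
  by exists 0%N; rewrite lt0n size_eq0.
have vmin' s t : t != [::] -> w = s ++ t -> v <=l t.
  move=> t0 E; apply: (vmin _ _ E); rewrite E size_cat -{1}[size s]addn0 ltn_add2l.
  by rewrite !lt0n !size_eq0.
have u0 : u != [::].
  apply: contra nl => /eqP u0; rewrite u0 /= in wE; apply: lyndonI => // s t s0 t0 E.
  rewrite lt_neqAle {2}wE (vmin' s) // andbT E eq_sym; apply/eqP/cat_neq_suffix => //.
exists u, v; split=> // t; rewrite wE; apply: shuffles_le_cat => p s uE s0.
rewrite leNgt; apply/negP => sv.
have := vmin' p (s ++ v); rewrite cat_neq0l // catA -uE => /(_ isT wE) le.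
have := @lexi_prefix_of _ _ s v [::] v sv; rewrite cats0 => /(_ le)[v2 v20 vE].
have vv2 : v <=l v2 by apply: (vmin' (u ++ s)); rewrite // -catA -vE.
have v2v : v2 <=l v by move: le; rewrite {1}vE lexi_cat.
by apply: (@cat_neq_suffix s v2) => //; rewrite -vE; apply: (@le_anti _ (seqlexi 'I_d));
  rewrite v2v vv2.
Qed.

End Lyndon.

(** * Primitive series and their exponentials *)

Arguments texpn : simpl never.

Section ShuffleSums.
Variables (R : numFieldType) (d : nat).
Implicit Types (S T L : tseries R d) (u v w : seq 'I_d).

Definition shuffle_sum S u v : R := \sum_(w <- shuffles u v) S w.

Lemma shuffle_sum0s S v : shuffle_sum S [::] v = S v.
Proof. by rewrite /shuffle_sum shuffles0s big_seq1. Qed.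

Lemma shuffle_sums0 S u : shuffle_sum S u [::] = S u.
Proof. by rewrite /shuffle_sum shuffless0 big_seq1. Qed.

Definition tshift (a : 'I_d) S : tseries R d := fun u => S (a :: u).

Lemma shuffle_sum_cons S a u b v : shuffle_sum S (a :: u) (b :: v) =
  shuffle_sum (tshift a S) u (b :: v) + shuffle_sum (tshift b S) (a :: u) v.
Proof. by rewrite /shuffle_sum shuffles_cons big_cat !big_map. Qed.

Lemma eq_shuffle_sum S T u v : S =1 T -> shuffle_sum S u v = shuffle_sum T u v.
Proof. by move=> E; apply: eq_bigr => w _. Qed.

Lemma shuffle_sum_lin a S T u v :
  shuffle_sum (fun t => a * S t + T t) u v = a * shuffle_sum S u v + shuffle_sum T u v.
Proof. by rewrite /shuffle_sum big_split -mulr_sumr. Qed.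

Lemma tshift_tmul a S T u :
  tshift a (tmul S T) u = S [::] * tshift a T u + tmul (tshift a S) T u.
Proof. by rewrite /tshift /tmul /= big_ord_recl. Qed.

(** The shuffle product and deconcatenation form a bialgebra. *)
Lemma shuffle_sum_tmul S T u v : shuffle_sum (tmul S T) u v =
  \sum_(i < (size u).+1) \sum_(j < (size v).+1)
    shuffle_sum S (take i u) (take j v) * shuffle_sum T (drop i u) (drop j v).
Proof.
elim: u v S => [|a u IHu] v S.
  rewrite shuffle_sum0s big_ord1; apply: eq_bigr => j _.
  by rewrite !take0 !drop0 !shuffle_sum0s.
elim: v S => [|b v IHv] S.
  rewrite shuffle_sums0; apply: eq_bigr => i _.
  by rewrite big_ord1 !take0 !drop0 !shuffle_sums0.
rewrite shuffle_sum_cons (eq_shuffle_sum _ _ (tshift_tmul a S T)).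
rewrite (eq_shuffle_sum _ _ (tshift_tmul b S T)) !shuffle_sum_lin IHu IHv.
rewrite addrACA -mulrDr -shuffle_sum_cons.
rewrite [in RHS]big_ord_recl [X in _ = X + _]big_ord_recl /= shuffle_sum0s -!addrA.
congr (_ + _); rewrite [X in _ + X = _]big_ord_recl addrCA /=; congr (_ + _).
  by apply: eq_bigr => j _; rewrite /= !shuffle_sum0s.
rewrite -big_split /=; apply: eq_bigr => i _.
rewrite big_ord_recl [in RHS]big_ord_recl /= !shuffle_sums0 -addrA; congr (_ + _).
rewrite -big_split /=; apply: eq_bigr => j _.
by rewrite -mulrDl -shuffle_sum_cons.
Qed.

(** Primitive for the coproduct dual to the shuffle product. *)
Definition tprimitive S : Prop := S [::] = 0 /\
  forall u v, u != [::] -> v != [::] -> shuffle_sum S u v = 0.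

(** In [shuffle_sum_tmul], only the splittings in which a first part is empty survive. *)
Lemma shuffle_sum_tmul_primitive S T u v : tprimitive S ->
  shuffle_sum (tmul S T) u v =
    \sum_(i < (size u).+1) S (take i u) * shuffle_sum T (drop i u) v
  + \sum_(j < (size v).+1) S (take j v) * shuffle_sum T u (drop j v).
Proof.
move=> [S0 Sp]; rewrite shuffle_sum_tmul.
have nt (x : seq 'I_d) (i : 'I_(size x).+1) : i != ord0 -> take i x != [::].
  by move=> i0; rewrite -size_eq0 size_takel //; rewrite -ltnS.
have E (i : 'I_(size u).+1) (j : 'I_(size v).+1) : shuffle_sum S (take i u) (take j v) =
    (j == ord0)%:R * S (take i u) + (i == ord0)%:R * S (take j v).
  have [->|i0] := eqVneq i ord0; have [->|j0] := eqVneq j ord0.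
  - by rewrite !take0 shuffle_sum0s S0 !mulr0 addr0.
  - by rewrite take0 shuffle_sum0s mul0r add0r mul1r.
  - by rewrite take0 shuffle_sums0 mul0r addr0 mul1r.
  by rewrite Sp ?nt // !mul0r addr0.
under eq_bigr => i _ do under eq_bigr => j _ do rewrite E mulrDl.
under eq_bigr => i _ do rewrite big_split.
rewrite big_split /=; congr (_ + _).
  apply: eq_bigr => i _; rewrite (bigD1 ord0) //= big1 ?addr0 => [|j j0].
    by rewrite mul1r drop0.
  by rewrite (negbTE j0) !mul0r.
rewrite exchange_big; apply: eq_bigr => j _;
  rewrite (bigD1 ord0) //= big1 ?addr0 => [|i i0].
  by rewrite mul1r drop0.
by rewrite (negbTE i0) !mul0r.
Qed.

Lemma shuffle_sum_tmul_primitive2 S T u v : tprimitive S -> tprimitive T ->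
  u != [::] -> v != [::] -> shuffle_sum (tmul S T) u v = S u * T v + S v * T u.
Proof.
move=> pS [T0 Tp] u0 v0; rewrite shuffle_sum_tmul_primitive //.
have nd (x : seq 'I_d) (i : 'I_(size x)) : drop i x != [::].
  by rewrite -size_eq0 size_drop subn_eq0 -ltnNge.
congr (_ + _); rewrite big_ord_recr /= take_size drop_size.
  by rewrite shuffle_sum0s big1 ?add0r // => i _; rewrite Tp ?mulr0.
by rewrite shuffle_sums0 big1 ?add0r // => i _; rewrite Tp ?mulr0.
Qed.

Lemma tmul_nil S T : tmul S T [::] = S [::] * T [::].
Proof. by rewrite /tmul big_ord1. Qed.

(** By [shuffle_sum_tmul_primitive2], the values of ST and TS on a shuffle product
    agree. *)
Lemma tprimitive_bracket S T : tprimitive S -> tprimitive T -> tprimitive (tbracket S T).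
Proof.
move=> pS pT; split=> [|u v u0 v0].
  by rewrite /tbracket !tmul_nil; case: pS => -> _; rewrite !mul0r mulr0 subrr.
rewrite (eq_shuffle_sum (T := fun t => -1 * tmul T S t + tmul S T t)); last first.
  by move=> t; rewrite /tbracket mulN1r addrC.
rewrite shuffle_sum_lin !shuffle_sum_tmul_primitive2 // mulN1r.
by rewrite [T u * _]mulrC [T v * _]mulrC [S v * T u + _]addrC addNr.
Qed.

Lemma tprimitive_lin a S T : tprimitive S -> tprimitive T ->
  tprimitive (fun u => a * S u + T u).
Proof.
move=> [S0 Sp] [T0 Tp]; split=> [|u v u0 v0]; first by rewrite S0 T0 mulr0 addr0.
by rewrite shuffle_sum_lin Sp ?Tp // mulr0 addr0.
Qed.

Lemma tprimitive0 : tprimitive (fun=> 0).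
Proof. by split=> // u v _ _; rewrite /shuffle_sum big1. Qed.

Lemma tprimitive_var i : tprimitive (tvar R i).
Proof.
split=> // u v u0 v0; rewrite /shuffle_sum big_seq big1 // => w /size_shuffles sw.
rewrite /tvar; case: eqP => // wE; move: sw; rewrite wE /=.
by case: u u0 => // a u _; case: v v0 => // b v _; rewrite /= addSn addnS.
Qed.

Lemma lie_series_primitive S : lie_series S -> tprimitive S.
Proof.
apply; split; last exact: tprimitive_bracket.
  split; [exact: tprimitive0 | exact: tprimitive_lin].
exact: tprimitive_var.
Qed.

Lemma tprimitive_truncate m S : tprimitive S -> tprimitive (ttruncate m S).
Proof.
move=> [S0 Sp]; split=> [|u v u0 v0]; first by rewrite /ttruncate /= S0.
have -> : shuffle_sum (ttruncate m S) u v =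
    if (size u + size v <= m)%N then shuffle_sum S u v else 0.
  rewrite /shuffle_sum; case: ifP => le_m; last first.
    rewrite big_seq big1 // => w /size_shuffles sw.
    by rewrite /ttruncate sw le_m.
  by apply: eq_big_seq => w /size_shuffles sw; rewrite /ttruncate sw le_m.
by case: ifP => // _; apply: Sp.
Qed.

(** Among words of one length, the smallest w with S w != 0 is Lyndon: for w = uv as in
    [nonlyndon_factor], the vanishing sum of S over the shuffles of u and v reduces
    to a positive multiple of S w. *)
Lemma primitive_eq0 m S : tprimitive S ->
    (forall l, lyndon l -> (size l <= m)%N -> S l = 0) ->
  forall u, (size u <= m)%N -> S u = 0.
Proof.
move=> [S0 Sp] Sl u um; apply/eqP; apply: contraT => Su.
pose F (t : (size u).-tuple 'I_d) := (val t : seqlexi 'I_d).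
have [w Sw wmin] := @arg_minP _ (seqlexi 'I_d) _ (in_tuple u) (fun t => S t != 0) F Su.
have w0 : (w : seq 'I_d) != [::] by apply: contraNneq Sw => ->; rewrite S0.
have wl : ~~ lyndon w by apply: contra Sw => lw; rewrite Sl ?size_tuple.
have [x [y [wE x0 y0 ymax]]] := nonlyndon_factor w0 wl.
have := Sp x y x0 y0; rewrite /shuffle_sum big_seq.
rewrite (eq_bigr (fun t => (t == w :> seq _)%:R * S w)) => [|t ht]; last first.
  have [->|ne] := eqVneq t w; first by rewrite mul1r.
  rewrite mul0r; apply/eqP; apply: contraNT ne => St.
  have st : size t == size u.
    by rewrite (size_shuffles ht) -size_cat -wE size_tuple.
  apply/eqP/(@le_anti _ (seqlexi 'I_d)); rewrite ymax //=.
  exact: (wmin (Tuple st)).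
rewrite -big_seq -mulr_suml => /eqP; rewrite mulf_eq0 (negbTE Sw) orbF.
have : (w : seq 'I_d) \in shuffles x y by rewrite wE cat_mem_shuffles.
move=> /(big_rem _) ->; rewrite eqxx => /eqP E.
suff : 0 < (1 + \sum_(t <- rem (w : seq 'I_d) (shuffles x y)) (t == w :> seq _)%:R : R).
  by rewrite [1 + _]E ltxx.
by apply: ltr_pwDl => //; apply: sumr_ge0 => t _; rewrite ler0n.
Qed.

Lemma texpn0 L : texpn L 0 = tone R (d := d). Proof. by []. Qed.

Lemma texpnS L j : texpn L j.+1 = tmul L (texpn L j).
Proof. by []. Qed.

Lemma texpn1 L u : texpn L 1 u = L u.
Proof.
rewrite texpnS texpn0 /tmul big_ord_recr /= take_size drop_size big1 ?add0r ?mulr1 // => i _.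
have di : drop i u != [::] by rewrite -size_eq0 size_drop subn_eq0 -ltnNge.
by rewrite /tone (negbTE di) mulr0.
Qed.

Lemma texpn_small L j u : L [::] = 0 -> (size u < j)%N -> texpn L j u = 0.
Proof.
move=> L0; elim: j u => // j IH u uj;
  rewrite texpnS /tmul big_ord_recl /= take0 L0 mul0r add0r.
rewrite big1 // => i _; rewrite IH ?mulr0 // size_drop /=.
by have := ltn_ord i; rewrite /bump /=; lia.
Qed.

Lemma texp_wide L B u : L [::] = 0 -> (size u < B)%N ->
  texp L u = \sum_(j < B) texpn L j u / j`!%:R.
Proof.
move=> L0 uB; rewrite /texp (big_ord_widen_cond _ xpredT (fun j => texpn L j u / j`!%:R) uB).
rewrite big_mkcond /=; apply: eq_bigr => j _; case: ifP => // /negbT.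
by rewrite -leqNgt => uj; rewrite texpn_small // mul0r.
Qed.

(** L is a derivation for the shuffle product, and this is the Leibniz formula. *)
Lemma shuffle_sum_texpn L n u v : tprimitive L ->
  shuffle_sum (texpn L n) u v =
    \sum_(i < n.+1) 'C(n, i)%:R * (texpn L i u * texpn L (n - i) v).
Proof.
move=> pL; elim: n u v => [|n IH] u v.
  rewrite big_ord1 bin0 mul1r.
  change (shuffle_sum (tone R (d := d)) u v = tone R u * tone R v).
  have [->|u0] := eqVneq u [::]; first by rewrite shuffle_sum0s /tone eqxx mul1r.
  rewrite {2}/tone (negbTE u0) mul0r /shuffle_sum big_seq big1 // => w /size_shuffles sw.
  rewrite /tone; case: w sw => //= /esym/eqP.
  by rewrite addn_eq0 size_eq0 (negbTE u0).
rewrite texpnS shuffle_sum_tmul_primitive //.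
have E1 : \sum_(i < (size u).+1) L (take i u) * shuffle_sum (texpn L n) (drop i u) v =
    \sum_(l < n.+1) 'C(n, l)%:R * (texpn L l.+1 u * texpn L (n - l) v).
  under eq_bigr => i _ do rewrite IH mulr_sumr.
  rewrite exchange_big; apply: eq_bigr => l _ /=.
  rewrite texpnS /tmul mulr_suml mulr_sumr; apply: eq_bigr => i _.
  by rewrite mulrCA !mulrA.
have E2 : \sum_(j < (size v).+1) L (take j v) * shuffle_sum (texpn L n) u (drop j v) =
    \sum_(l < n.+1) 'C(n, l)%:R * (texpn L l u * texpn L (n.+1 - l) v).
  under eq_bigr => i _ do rewrite IH mulr_sumr.
  rewrite exchange_big; apply: eq_bigr => l _ /=.
  have ln : (l <= n)%N by rewrite -ltnS.
  rewrite subSn // texpnS /tmul !mulr_sumr; apply: eq_bigr => i _.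
  by rewrite mulrCA; congr (_ * _); rewrite mulrCA.
rewrite E1 E2 {E1 E2 IH}; pose F l := texpn L l u * texpn L (n.+1 - l) v.
rewrite [RHS](eq_bigr (fun l : 'I_n.+2 => 'C(n.+1, l)%:R * F l)) //.
rewrite [RHS]big_ord_recl bin0.
under [in RHS]eq_bigr => l _ do rewrite lift0 binS natrD mulrDl.
rewrite big_split /= addrA addrC; congr (_ + _).
transitivity (\sum_(l < n.+2) 'C(n, l)%:R * F l).
  by rewrite [RHS]big_ord_recr /= (@bin_small n n.+1) // mul0r addr0.
by rewrite big_ord_recl bin0.
Qed.

(** Dividing the Leibniz formula by n! shows that both sides are Cauchy products; they
    are compared as values at 1 of polynomials. *)
Lemma texp_grouplike L u v : tprimitive L ->
  texp L u * texp L v = \sum_(w <- shuffles u v) texp L w.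
Proof.
move=> pL; have [L0 _] := pL.
(* the generating polynomial of the coefficients of L^j / j! at x *)
pose ep (x : seq 'I_d) : {poly R} := \poly_(j < (size x).+1) (texpn L j x / j`!%:R).
have ep1 x : (ep x).[1] = texp L x.
  rewrite (@horner_coef_wide _ (size x).+1) ?size_poly //; apply: eq_bigr => j _.
  by rewrite coef_poly ltn_ord expr1n mulr1.
have epc x j : (ep x)`_j = texpn L j x / j`!%:R.
  by rewrite coef_poly ltnS leqNgt; case: ltnP => // xj; rewrite texpn_small // mul0r.
rewrite -!ep1 -hornerM (@horner_coef_wide _ (size u + size v).+1); last first.
  apply: leq_trans (size_polyMleq _ _) _; rewrite -subn1 leq_subLR add1n -addSn -addnS.
  by apply: leq_add; apply: size_poly.
rewrite (eq_big_seq (fun w => \sum_(j < (size u + size v).+1) texpn L j w / j`!%:R));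
  last first.
  by move=> w /size_shuffles sw; apply: texp_wide; rewrite ?sw.
rewrite exchange_big; apply: eq_bigr => n _ /=.
rewrite expr1n mulr1 coefM -mulr_suml [X in _ = X / _]shuffle_sum_texpn // mulr_suml.
apply: eq_bigr => i _; rewrite !epc.
have in' : (i <= n)%N by rewrite -ltnS.
have nz (j : nat) : (j`!%:R : R) != 0 by rewrite pnatr_eq0 -lt0n fact_gt0.
have := congr1 (fun x => x%:R : R) (bin_fact in'); rewrite !natrM => <-.
have C0 : ('C(n, i)%:R : R) != 0 by rewrite pnatr_eq0 -lt0n bin_gt0.
by field; rewrite !nz C0.
Qed.

End ShuffleSums.

(** * Coefficients of exponentials and a dual basis for Lyndon words *)

Section CoefficientSpan.
Variables (R : numFieldType) (d : nat) (C : Type) (L : C -> tseries R d).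
Hypothesis L_primitive : forall c, tprimitive (L c).
Implicit Types (f g : C -> R) (u v w : seq 'I_d).

Definition coef_span k f : Prop := exists b : k.-tuple 'I_d -> R,
  forall c, f c = \sum_(t : k.-tuple 'I_d) b t * texp (L c) t.

Lemma coef_span_ext k f g : f =1 g -> coef_span k f -> coef_span k g.
Proof. by move=> E [b bE]; exists b => c; rewrite -E. Qed.

Lemma coef_span_word u : coef_span (size u) (fun c => texp (L c) u).
Proof.
exists (fun t => (t == in_tuple u)%:R) => c.
rewrite (bigD1 (in_tuple u)) //= eqxx mul1r big1 ?addr0 // => t /negbTE ->.
by rewrite mul0r.
Qed.

Lemma coef_span0 k : coef_span k (fun=> 0).
Proof. by exists (fun=> 0) => c; rewrite big1 // => t _; rewrite mul0r. Qed.

Lemma coef_span_lin k a f g : coef_span k f -> coef_span k g ->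
  coef_span k (fun c => a * f c + g c).
Proof.
move=> [b bE] [b' bE']; exists (fun t => a * b t + b' t) => c.
rewrite bE bE' mulr_sumr -big_split; apply: eq_bigr => t _.
by rewrite mulrDl mulrA.
Qed.

Lemma coef_span_sum k (I : Type) (s : seq I) (a : I -> R) (F : I -> C -> R) :
  (forall i, coef_span k (F i)) -> coef_span k (fun c => \sum_(i <- s) a i * F i c).
Proof.
move=> h; elim: s => [|i s IH].
  by apply: coef_span_ext (coef_span0 k) => c; rewrite big_nil.
apply: coef_span_ext (coef_span_lin (a i) (h i) IH) => c.
by rewrite big_cons.
Qed.

(** A product of two coefficients is a sum of coefficients by [texp_grouplike]. *)
Lemma coef_spanM k l f g : coef_span k f -> coef_span l g ->
  coef_span (k + l) (fun c => f c * g c).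
Proof.
move=> [b bE] [b' bE'].
have h (t : k.-tuple 'I_d) (t' : l.-tuple 'I_d) :
    coef_span (k + l) (fun c => texp (L c) t * texp (L c) t').
  apply: (@coef_span_ext _ (fun c => \sum_(w <- shuffles t t') texp (L c) w)).
    by move=> c; rewrite texp_grouplike.
  have : {in shuffles t t', forall w, size w = (k + l)%N}.
    by move=> w /size_shuffles; rewrite !size_tuple.
  elim: (shuffles t t') => [|w s IH] hs.
    by apply: coef_span_ext (coef_span0 _) => c; rewrite big_nil.
  have hw : coef_span (k + l) (fun c => texp (L c) w).
    by rewrite -(hs w (mem_head _ _)); apply: coef_span_word.
  apply: coef_span_ext (coef_span_lin 1 hw (IH _)) => [c|w' hw'].
    by rewrite mul1r big_cons.
  by apply: hs; rewrite inE hw' orbT.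
apply: coef_span_ext (coef_span_sum (index_enum _) b
  (fun t => coef_span_sum (index_enum _) b' (fun t' => h t t'))) => c /=.
rewrite bE bE' mulr_suml; apply: eq_bigr => t _; rewrite mulr_sumr mulr_sumr.
by apply: eq_bigr => t' _; rewrite mulrACA !mulrA.
Qed.

(** By induction on the length of u.  For j >= 1 the coefficient of L^(j+1) at u is a
    sum of products of coefficients at shorter words, and the coefficient of L
    itself is that of exp L minus those of L^j / j! for j >= 2. *)
Lemma coef_span_log u j : u != [::] ->
  coef_span (size u) (fun c => texpn (L c) j.+1 u).
Proof.
have [N] := ubnP (size u); elim: N u j => // N IH u j uN u0.
have L0 c : L c [::] = 0 by case: (L_primitive c).
have hS i : coef_span (size u) (fun c => texpn (L c) i.+2 u).
  apply: (@coef_span_ext _ (fun c => \sum_(l <- iota 0 (size u).-1)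
      1 * (texpn (L c) 1 (take l.+1 u) * texpn (L c) i.+1 (drop l.+1 u)))).
    move=> c /=; rewrite [in RHS]texpnS /tmul -(big_mkord xpredT
      (fun l => L c (take l u) * texpn (L c) i.+1 (drop l u))).
    have su : size u = (size u).-1.+1 by rewrite prednK // lt0n size_eq0.
    rewrite {2}su big_nat_recl // big_nat_recr //= take0 L0 mul0r add0r -su.
    rewrite drop_size texpn_small // mulr0 addr0.
    by rewrite /index_iota subn0; apply: eq_bigr => l _; rewrite mul1r texpn1.
  have : {in iota 0 (size u).-1, forall l, l.+1 < size u}%N.
    by move=> l; rewrite mem_iota; lia.
  elim: (iota _ _) => [|l s IHs] hs.
    by apply: coef_span_ext (coef_span0 _) => c; rewrite big_nil.
  have lu := hs l (mem_head _ _).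
  have sl : size (take l.+1 u) = l.+1 by rewrite size_takel // ltnW.
  have hl : coef_span (size u)
      (fun c => texpn (L c) 1 (take l.+1 u) * texpn (L c) i.+1 (drop l.+1 u)).
    have -> : size u = (size (take l.+1 u) + size (drop l.+1 u))%N.
      by rewrite -size_cat cat_take_drop.
    apply: coef_spanM; apply: IH.
    - by rewrite sl; lia.
    - by rewrite -size_eq0 sl.
    - by rewrite size_drop; lia.
    - by rewrite -size_eq0 size_drop -lt0n subn_gt0.
  apply: coef_span_ext (coef_span_lin 1 hl (IHs _)) => [c|l' hl'].
    by rewrite big_cons.
  by apply: hs; rewrite inE hl' orbT.
case: j => [|j]; last exact: hS.
have h2 := coef_span_sum (index_iota 0 (size u)) (fun i => - (i.+2`!%:R)^-1) hS.
apply: coef_span_ext (coef_span_lin 1 (coef_span_word u) h2) => c.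
rewrite mul1r (@texp_wide _ _ _ (size u).+2) // !big_ord_recl /= texpn0 /tone (negbTE u0).
rewrite mul0r add0r /bump /= add1n divr1 big_mkord -addrA -big_split big1 ?addr0 // => i _.
by rewrite /= !add1n mulNr [X in _ - X]mulrC subrr.
Qed.

End CoefficientSpan.

Section LyndonBasis.
Variables (R : numFieldType) (d : nat).
Implicit Types (S T : tseries R d) (u v l : seq 'I_d).

Notation "u <=l v" := (@Order.le _ (seqlexi 'I_d) u v) (at level 70).
Notation "u <l v" := (@Order.lt _ (seqlexi 'I_d) u v) (at level 70).

Lemma lie_series_var (i : 'I_d) : lie_series (tvar R i).
Proof. by move=> V [_ h _]; apply: h. Qed.

Lemma lie_series_bracket S T : lie_series S -> lie_series T -> lie_series (tbracket S T).
Proof. by move=> hS hT V hV; case: (hV) => _ _ h; apply: h; [apply: hS | apply: hT]. Qed.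

Lemma lie_series_lin a S T : lie_series S -> lie_series T ->
  lie_series (fun u => a * S u + T u).
Proof. by move=> hS hT V hV; case: (hV) => -[_ h] _ _; apply: h;
  [apply: hS | apply: hT]. Qed.

Lemma lie_series0 : lie_series ((fun=> 0) : tseries R d).
Proof. by move=> V [[]]. Qed.

Lemma lie_series_sum (I : Type) (s : seq I) (a : I -> R) (F : I -> tseries R d) :
  (forall i, lie_series (F i)) -> lie_series (fun u => \sum_(i <- s) a i * F i u).
Proof.
move=> h; elim: s => [|i s IH].
  by rewrite (_ : (fun _ => _) = fun=> 0);
    [exact: lie_series0 | apply/funext => u; rewrite big_nil].
rewrite (_ : (fun _ => _) = fun u => a i * F i u + \sum_(i <- s) a i * F i u).
  exact: lie_series_lin.
by apply/funext => u; rewrite big_cons.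
Qed.

Definition leading S l : Prop :=
  (forall u, S u != 0 -> size u = size l /\ l <=l u) /\ S l = 1.

Lemma lexi_cat2 u v x y : size u = size x -> x <=l u -> y <=l v -> x ++ y <=l u ++ v.
Proof.
move=> s; case/lexi_cases => [[t E]|[c [a [b [s' [t' [-> -> ab]]]]]]] yv.
  have /eqP : size t = 0%N.
    by move: s; rewrite E size_cat -[X in _ = X]addn0 => /addnI.
  by rewrite size_eq0 E => /eqP ->; rewrite cats0 lexi_cat.
by rewrite -!catA; apply/ltW/ltxi_branch.
Qed.

Lemma leading_tmul S T u v : leading S u -> leading T v ->
  leading (tmul S T) (u ++ v).
Proof.
move=> [hS Su] [hT Tv]; split=> [t|].
  move=> nz; have [j] : exists j : 'I_(size t).+1, S (take j t) * T (drop j t) != 0.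
    apply: contrapT => H; case/eqP: nz; rewrite /tmul big1 // => j _.
    by apply/eqP; apply: contrapT => nz; apply: H; exists j; apply/negP.
  rewrite mulf_eq0 => /norP[/hS[s1 l1] /hT[s2 l2]].
  by rewrite -(cat_take_drop j t) !size_cat s1 s2; split=> //; apply: lexi_cat2.
have lt : (size u < (size (u ++ v)).+1)%N by rewrite ltnS size_cat leq_addr.
rewrite /tmul (bigD1 (Ordinal lt)) //= take_size_cat // drop_size_cat // Su Tv mulr1.
rewrite big1 ?addr0 // => j ne; apply/eqP; apply: contraNT ne.
rewrite mulf_eq0 => /norP[/hS[s1 _] _]; rewrite -val_eqE /= -s1 size_takel //.
by rewrite -ltnS.
Qed.

(** For w = uv as in [lyndon_factor], [P_u, P_v] = P_u P_v - P_v P_u has uv as its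
    smallest word since w < vu. *)
Lemma lyndon_leading l : lyndon l -> exists2 S, lie_series S & leading S l.
Proof.
have [N] := ubnP (size l); elim: N l => // N IH l lN ll.
have [l1|l1] := leqP (size l) 1.
  case: l ll l1 {lN} => [|i [|j l]] //.
  move=> _ _; exists (tvar R i); first exact: lie_series_var.
  split=> [u|]; rewrite /tvar; last by rewrite eqxx.
  by have [->|_] := eqVneq u [:: i]; [split=> //; exact: lexx | rewrite eqxx].
have [u [v [lE lu lv lt_vu]]] := lyndon_factor ll l1.
have [u0 v0] : u != [::] /\ v != [::] by case/lyndonP: lu; case/lyndonP: lv.
have su : (size u < N)%N.
  by rewrite -ltnS (leq_trans _ lN) // lE size_cat !ltnS -addn1 leq_add2l lt0n size_eq0.
have sv : (size v < N)%N.
  by rewrite -ltnS (leq_trans _ lN) // lE size_cat !ltnS -add1n leq_add2r lt0n size_eq0.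
have [S hS lS] := IH u su lu; have [T hT lT] := IH v sv lv.
exists (tbracket S T); first exact: lie_series_bracket.
have [h1 e1] := leading_tmul lS lT; have [h2 e2] := leading_tmul lT lS.
have z : tmul T S l = 0.
  apply/eqP; apply: contraT => /h2[_]; rewrite leNgt.
  by rewrite lt_vu.
split=> [t|]; last by rewrite /tbracket z lE e1 subr0.
rewrite /tbracket => nz; have [E|/h1[s1 l2]] := eqVneq (tmul S T t) 0; last by rewrite lE.
move: nz; rewrite E sub0r oppr_eq0 => /h2[s2 l2]; split.
  by rewrite s2 lE !size_cat addnC.
exact/ltW/(lt_le_trans lt_vu l2).
Qed.

Variable m : nat.
Notation n := (size (lyndon_weights d m)).

Definition lyndon_words : seq (seq 'I_d) :=
  flatten [seq [seq val t | t <- enum [pred u : i.-tuple 'I_d | lyndon u]] | i <- iota 1 m].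

Lemma size_lyndon_words : map size lyndon_words = lyndon_weights d m.
Proof.
rewrite /lyndon_words /lyndon_weights map_flatten -map_comp; congr flatten.
apply: eq_map => i /=; rewrite /num_lyndon cardE -map_comp.
by elim: (enum _) => //= t s ->; rewrite size_tuple.
Qed.

Lemma mem_lyndon_words l :
  (l \in lyndon_words) = lyndon l && (0 < size l <= m)%N.
Proof.
apply/flattenP/andP => [[_ /mapP[i im ->] /mapP[t]]|[ll sl]].
  by rewrite mem_enum inE => lt ->; move: im; rewrite mem_iota size_tuple; split=> //;
    lia.
exists [seq val t | t <- enum [pred u : (size l).-tuple 'I_d | lyndon u]].
  by apply/mapP; exists (size l) => //; rewrite mem_iota; lia.
by apply/mapP; exists (in_tuple l) => //; rewrite mem_enum inE.
Qed.

Lemma uniq_lyndon_words : uniq lyndon_words.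
Proof.
rewrite /lyndon_words; elim: (iota 1 m) (iota_uniq 1 m) => //= i s IH /andP[is_ us].
rewrite cat_uniq IH // (map_inj_uniq val_inj) enum_uniq andbT /=.
apply/hasPn => l /flattenP[_ /mapP[j js ->] /mapP[t _ ->]].
apply/negP => /mapP[t' _ /(congr1 size)]; rewrite !size_tuple => ji.
by move: is_; rewrite -ji js.
Qed.

Definition lyndon_word (j : 'I_n) : seq 'I_d := nth [::] lyndon_words j.

Lemma ord_lyndon_words (j : 'I_n) : (j < size lyndon_words)%N.
Proof. by rewrite -(size_map size) size_lyndon_words. Qed.

Lemma size_lyndon_word j : size (lyndon_word j) = lyndon_weight d m j.
Proof.
rewrite /lyndon_weight (tnth_nth 0%N) /= /lyndon_word.
by rewrite -(nth_map [::] 0%N size) ?ord_lyndon_words // size_lyndon_words.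
Qed.

Lemma lyndon_lyndon_word j : lyndon (lyndon_word j).
Proof.
by have := mem_nth [::] (ord_lyndon_words j); rewrite mem_lyndon_words => /andP[].
Qed.

Lemma lyndon_weight_bounds j : (0 < lyndon_weight d m j <= m)%N.
Proof.
by have := mem_nth [::] (ord_lyndon_words j);
  rewrite mem_lyndon_words -size_lyndon_word => /andP[].
Qed.

Lemma lyndon_word_inj : injective lyndon_word.
Proof.
move=> i j /eqP; rewrite nth_uniq ?ord_lyndon_words ?uniq_lyndon_words // => /eqP.
exact: val_inj.
Qed.

Lemma lyndon_word_surj l : lyndon l -> (size l <= m)%N -> exists j, lyndon_word j = l.
Proof.
move=> ll lm; have lw : l \in lyndon_words.
  by rewrite mem_lyndon_words ll lm lt0n size_eq0 andbT /=; case/lyndonP: ll.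
have lt : (index l lyndon_words < n)%N.
  by rewrite -size_lyndon_words size_map index_mem.
by exists (Ordinal lt); rewrite /lyndon_word nth_index.
Qed.

(** The matrix of the coefficients at Lyndon words of the Lie polynomials of
    [lyndon_leading] is triangular for the lexicographic order, hence invertible.
    It is block diagonal by length, so the blocks of its inverse invert its
    blocks. *)
Lemma lyndon_dual_basis : exists Q : 'I_n -> tseries R d,
  [/\ forall j, lie_series (Q j),
      forall j u, size u != lyndon_weight d m j -> Q j u = 0 &
      forall i j, Q i (lyndon_word j) = (i == j)%:R].
Proof.
have /choice[P PP] : forall j : 'I_n, exists S, lie_series S /\ leading S (lyndon_word j).
  by move=> j; have [S] := lyndon_leading (lyndon_lyndon_word j); exists S.
have P0 j u : size u != lyndon_weight d m j -> P j u = 0.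
  have [_ [h _]] := PP j; move=> ne; apply/eqP; apply: contraNT ne => /h[-> _].
  by rewrite size_lyndon_word.
pose A := \matrix_(i < n, j < n) P i (lyndon_word j).
have A0 i j : lyndon_weight d m j != lyndon_weight d m i -> A i j = 0.
  by move=> ne; rewrite mxE P0 // size_lyndon_word.
have : row_free A.
  apply: inj_row_free => v vA; apply/eqP; apply: contraT => v0.
  have [i0 vi0] : exists i, v 0 i != 0.
    apply: contrapT => H; case/eqP: v0; apply/rowP => i; rewrite mxE.
    by apply/eqP; apply: contrapT => nz; apply: H; exists i; apply/negP.
  have [i vi imin] := @arg_minP _ (seqlexi 'I_d) _ i0 (fun i => v 0 i != 0)
    (fun i => lyndon_word i : seqlexi 'I_d) vi0.
  have := congr1 (fun M : 'rV_n => M 0 i) vA; rewrite !mxE (bigD1 i) //= big1 => [|j ji].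
    have [_ [_ Pi]] := PP i; rewrite mxE Pi mulr1 addr0 => E.
    by move: vi; rewrite /= E eqxx.
  apply/eqP; apply: contraNT ji; rewrite mulf_eq0 => /norP[vj].
  rewrite mxE; have [_ [h _]] := PP j => /h[_ le].
  by apply/eqP/lyndon_word_inj/(@le_anti _ (seqlexi 'I_d)); rewrite le imin.
rewrite row_free_unit => Au; pose B := invmx A.
have BA (i l : 'I_n) : \sum_(j < n) B i j * A j l = (i == l)%:R.
  have := congr1 (fun M : 'M_n => M i l) (mulVmx Au).
  by rewrite /B !mxE.
(* the diagonal blocks of the inverse *)
pose b i j := if lyndon_weight d m j == lyndon_weight d m i then B i j else 0.
exists (fun i u => \sum_(j <- index_enum 'I_n) b i j * P j u); split.
- by move=> i; apply: lie_series_sum => j; case: (PP j).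
- move=> i u su; rewrite big1 // => j _; rewrite /b; case: eqP => E;
  last by rewrite mul0r.
  by rewrite P0 ?mulr0 // E.
move=> i l; have [E|ne] := eqVneq (lyndon_weight d m l) (lyndon_weight d m i).
  rewrite -BA; apply: eq_bigr => j _; rewrite /b; case: eqP => E'.
    by rewrite mxE.
  rewrite mul0r A0 ?mulr0 // E; apply/eqP => E''; exact: E'.
rewrite big1 => [|j _].
  by have [il|] := eqVneq i l; last by []; rewrite il eqxx in ne.
rewrite /b; case: eqP => E; last by rewrite mul0r.
by rewrite P0 ?mulr0 // size_lyndon_word E.
Qed.

End LyndonBasis.

(** * The rough Veronese variety *)

Section LieCoordinates.
Variables (R : numFieldType) (d m : nat).
Notation n := (size (lyndon_weights d m)).
Notation w := (lyndon_weight d m).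

Definition lie_point (Q : 'I_n -> tseries R d) (c : 'rV[R]_n) : tseries R d :=
  fun u => \sum_j c 0 j * Q j u.

(** A truncated Lie series L and the combination of the Q_j with the same
    coefficients at Lyndon words differ by a primitive series that vanishes at
    Lyndon words, hence by 0 ([primitive_eq0]). *)
Lemma lie_truncated_coordinates : exists Q : 'I_n -> tseries R d,
  [/\ forall c, tprimitive (lie_point Q c),
      forall j u, size u != w j -> Q j u = 0,
      forall c j, lie_point Q c (lyndon_word j) = c 0 j &
      forall L, lie_truncated m L <-> exists c, L = lie_point Q c].
Proof.
have [Q [Qlie Q0 Qdual]] := lyndon_dual_basis R d m; exists Q.
have plie c : lie_series (lie_point Q c) by apply: lie_series_sum.
have Qm c u : (m < size u)%N -> lie_point Q c u = 0.
  move=> mu; apply: big1 => j _; rewrite Q0 ?mulr0 //.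
  by have := lyndon_weight_bounds j; lia.
have coord c j : lie_point Q c (lyndon_word j) = c 0 j.
  rewrite /lie_point (bigD1 j) //= Qdual eqxx mulr1 big1 ?addr0 // => i ij.
  by rewrite Qdual (negbTE ij) mulr0.
split=> // [c|L]; first exact: lie_series_primitive.
split=> [[S hS <-]|[c ->]]; last first.
  exists (lie_point Q c) => //; apply/funext => u; rewrite /ttruncate.
  by case: leqP => // mu; rewrite Qm.
pose c : 'rV[R]_n := \row_j S (lyndon_word j); exists c; apply/funext => u.
have [um|mu] := leqP (size u) m; last by rewrite Qm // /ttruncate leqNgt mu.
have pS := tprimitive_truncate m (lie_series_primitive hS).
have pD := tprimitive_lin (-1) (lie_series_primitive (plie c)) pS.
have := primitive_eq0 (m := m) pD _ um; rewrite mulN1r addrC => /(_ _)/subr0_eq; apply.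
move=> l ll lm; have [j jl] := lyndon_word_surj ll lm.
by rewrite -jl coord mxE /ttruncate jl lm mulN1r addNr.
Qed.

Variable Q : 'I_n -> tseries R d.
Hypothesis Q_primitive : forall c, tprimitive (lie_point Q c).
Hypothesis Q_homog : forall j u, size u != w j -> Q j u = 0.
Hypothesis Q_coord : forall c j, lie_point Q c (lyndon_word j) = c 0 j.

Definition graded_poly k (f : 'rV[R]_n -> R) : Prop :=
  exists p : {mpoly R[n]}, p \is k.-homog for (wdeg w) /\ forall c, f c = p.@[c 0].

Lemma graded_poly_sum k (I : finType) (F : I -> 'rV[R]_n -> R) :
  (forall i, graded_poly k (F i)) -> graded_poly k (fun c => \sum_i F i c).
Proof.
move=> /choice[p hp]; exists (\sum_i p i); split.
  by apply: rpred_sum => i _; case: (hp i).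
by move=> c; rewrite raddf_sum; apply: eq_bigr => i _; case: (hp i).
Qed.

Lemma graded_polyM k l f g : graded_poly k f -> graded_poly l g ->
  graded_poly (k + l) (fun c => f c * g c).
Proof.
move=> [p [hp pE]] [q [hq qE]]; exists (p * q); split; first exact: dhomogM.
by move=> c; rewrite mevalM pE qE.
Qed.

Lemma graded_polyZ k a f : graded_poly k f -> graded_poly k (fun c => f c * a).
Proof.
by move=> [p [hp pE]]; exists (a *: p); split=> [|c]; rewrite ?rpredZ // mevalZ pE mulrC.
Qed.

Lemma graded_lie_point u : graded_poly (size u) (fun c => lie_point Q c u).
Proof.
apply: graded_poly_sum => j; have [E|ne] := eqVneq (size u) (w j).
  apply: graded_polyZ; exists 'X_j; split=> [|c]; last by rewrite mevalXU.
  by rewrite dhomogX /= wdeg_mnm1 E.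
by exists 0; split=> [|c]; [exact: dhomog0 | rewrite meval0 Q_homog ?mulr0].
Qed.

Lemma graded_texp u : graded_poly (size u) (fun c => texp (lie_point Q c) u).
Proof.
apply: graded_poly_sum => i; apply: graded_polyZ.
move: (nat_of_ord i) => {}i; elim: i u => [|i IH] u.
  have [->|u0] := eqVneq u [::].
    by exists 1; split=> [|c]; [exact: dhomog1 | rewrite meval1].
  by exists 0; split=> [|c]; [exact: dhomog0 | rewrite meval0 texpn0 /tone (negbTE u0)].
apply: (graded_poly_sum (F := fun (j : 'I_(size u).+1) c =>
  lie_point Q c (take j u) * texpn (lie_point Q c) i (drop j u))) => j.
have {1}-> : size u = (size (take j u) + size (drop j u))%N.
  by rewrite -size_cat cat_take_drop.
by apply: graded_polyM => //; apply: graded_lie_point.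
Qed.

(** The coordinate c_j is the coefficient of the Lie series at the j-th Lyndon word,
    hence in the span by [coef_span_log]; products stay in it. *)
Lemma coef_span_monomial M :
  coef_span (lie_point Q) (wdeg w M) (fun c => \prod_i c 0 i ^+ M i).
Proof.
have span1 : coef_span (lie_point Q) 0 (fun=> 1).
  apply: coef_span_ext (coef_span_word (lie_point Q) [::]) => c.
  by rewrite /texp big_ord1 texpn0 /tone eqxx fact0 divr1.
have spanX (i : 'I_n) j : coef_span (lie_point Q) (w i * j) (fun c => c 0 i ^+ j).
  elim: j => [|j IH]; first by rewrite muln0; apply: coef_span_ext span1 => c.
  have wi : lyndon_word i != [::].
    by rewrite -size_eq0 size_lyndon_word -lt0n; case/andP: (lyndon_weight_bounds i).
  have := coef_span_log Q_primitive 0 wi; rewrite size_lyndon_word => hi.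
  rewrite mulnS; apply: coef_span_ext (coef_spanM Q_primitive hi IH) => c.
  by rewrite texpn1 Q_coord exprS.
rewrite /wdeg; elim: (index_enum _) => [|i s IH].
  by rewrite big_nil; apply: coef_span_ext span1 => c; rewrite big_nil.
rewrite big_cons; apply: coef_span_ext (coef_spanM Q_primitive (spanX i (M i)) IH) => c.
by rewrite big_cons.
Qed.

End LieCoordinates.

Lemma map_mpoly_meval (A B : comNzRingType) (f : {rmorphism A -> B}) n
    (p : {mpoly A[n]}) (v : 'I_n -> A) :
  (map_mpoly f p).@[fun i => f (v i)] = f p.@[v].
Proof.
rewrite /map_mpoly /mmap raddf_sum [in RHS]mevalE raddf_sum /=.
apply: eq_bigr => M _; rewrite mevalM mevalC rmorphM /mmap1 !rmorph_prod.
congr (_ * _); apply: eq_bigr => i _.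
by rewrite !rmorphXn /= mevalXU.
Qed.

Lemma dhomog_map_mpoly (A B : nzRingType) (f : {rmorphism A -> B}) n
    (w : 'I_n -> nat) D (p : {mpoly A[n]}) :
  p \is D.-homog for (wdeg w) -> map_mpoly f p \is D.-homog for (wdeg w).
Proof.
move=> /dhomogP hp; apply/dhomogP => M; rewrite mcoeff_msupp mcoeff_map_mpoly => nz.
by apply: hp; rewrite mcoeff_msupp; apply/eqP => p0; rewrite p0 raddf0 eqxx in nz.
Qed.

(** Gives Lyndon words of every length when there are two letters. *)
Lemma lyndon_nseq_rcons d (a b : 'I_d) j : (a < b)%O -> lyndon (rcons (nseq j a) b).
Proof.
move=> ab; apply/lyndonP; split=> [|i]; first by case: j.
rewrite size_rcons size_nseq ltnS => /andP[i0 ij].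
have jE : nseq j a = nseq (j - i) a ++ nseq i a by rewrite -nseqD subnK.
have -> : drop i (rcons (nseq j a) b) = nseq (j - i) a ++ [:: b].
  rewrite -cats1 -{1}(subnKC ij) nseqD -catA drop_size_cat ?size_nseq //.
rewrite -cats1 jE -catA ltxi_cat; case: i i0 {ij jE} => // i _.
exact: (@ltxi_branch _ _ [::]).
Qed.

Lemma lyndon_word_exists d i : (2 <= d)%N -> (1 <= i)%N ->
  exists2 l : seq 'I_d, lyndon l & size l = i.
Proof.
case: d => [|[|d]] // _; case: i => // i _.
exists (rcons (nseq i ord0) ord_max); last by rewrite size_rcons size_nseq.
exact: lyndon_nseq_rcons.
Qed.

Lemma lyndon_weight_exists d m i : (2 <= d)%N -> (1 <= i <= m)%N ->
  exists j, lyndon_weight d m j = i.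
Proof.
move=> d2 /andP[i1 im]; have [l ll sl] := lyndon_word_exists d2 i1.
have [|j jl] := @lyndon_word_surj d m l ll; first by rewrite sl.
by exists j; rewrite -size_lyndon_word jl.
Qed.

Lemma lyndon_letter d (i : 'I_d) : lyndon [:: i].
Proof. by apply/lyndonP; split=> // -[|[]]. Qed.

Lemma lyndon_weight1_exists2 d m : (2 <= d)%N -> (1 <= m)%N ->
  exists x y, [/\ x != y, lyndon_weight d m x = 1%N & lyndon_weight d m y = 1%N].
Proof.
case: d => [|[|d]] // _ m1.
have [x xE] := lyndon_word_surj (lyndon_letter (ord0 : 'I_d.+2)) m1.
have [y yE] := lyndon_word_surj (lyndon_letter (ord_max : 'I_d.+2)) m1.
exists x, y; split; rewrite -?size_lyndon_word ?xE ?yE //.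
by apply/eqP => xy; move: xE; rewrite xy yE.
Qed.

Section Embedding.
Variables (K : numClosedFieldType) (n : nat) (w : 'I_n -> nat) (m k : nat).
Hypotheses (w_bounds : forall i, (0 < w i <= m)%N) (k0 : (0 < k)%N) (n0 : (0 < n)%N).
Hypothesis dvd_k : forall i, (1 <= i <= m)%N -> (i %| k)%N.

Lemma bounded_weight_gt0 i : (0 < w i)%N.
Proof. by case/andP: (w_bounds i). Qed.

Lemma bounded_weight_dvd i : (w i %| k)%N.
Proof. exact: dvd_k (w_bounds i). Qed.

Lemma bounded_weight_packing (M : 'X_{1..n}) j : wdeg w M = (j.+1 * k)%N ->
  exists M1 M2, M = (M1 + M2)%MM /\ wdeg w M1 = k.
Proof. by move=> wM; apply: monomial_packing wM. Qed.

(** All monomials of weighted degree k are among the coordinates, since positive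
    weights bound the degree by k. *)
Lemma wmonomial_map_embedding :
  rational_map_embedding w (@std_weight _) (@wmonomial_map K _ w k).
Proof.
pose G := [tuple 'X_[wmonomial_nth j] | j < #|{: wmonomial w k}|] :
  (#|{: wmonomial w k}|).-tuple {mpoly K[n]}.
have GE j : tnth G j = 'X_[wmonomial_nth j] by rewrite tnth_mktuple.
have Gh j : tnth G j \is k.-homog for (wdeg w).
  by rewrite GE dhomogX /=; apply/eqP/wdeg_wmonomial_nth.
have Gs M : wdeg w M = k -> exists b : 'I_#|{: wmonomial w k}| -> K,
    'X_[M] = \sum_j b j *: tnth G j.
  move=> wM; have dM : (mdeg M <= k)%N.
    rewrite -wM mdegE; apply: leq_sum => i _.
    by rewrite leq_pmull // bounded_weight_gt0.
  have [j jM] := wmonomial_nth_surj wM dM; exists (fun j' => (j' == j)%:R).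
  rewrite (bigD1 j) //= eqxx scale1r GE jM big1 ?addr0 // => j' ne.
  by rewrite (negbTE ne) scale0r.
have FE v : system_map G v = wmonomial_map w k v.
  by apply/rowP => j; rewrite !mxE GE.
exists (system_proj bounded_weight_dvd Gs); split=> [x hx|].
  by apply/wpoint_eqP; exists 1 => [|j]; rewrite ?oner_neq0 // expr1n mul1r FE.
apply: system_proj_closed_immersion => //; first exact: bounded_weight_gt0.
exact: bounded_weight_packing.
Qed.

End Embedding.

Section RoughVeronese.
Variables (R : realType) (d m k : nat).
Notation n := (size (lyndon_weights d m)).
Notation w := (lyndon_weight d m).
Notation N := #|{: k.-tuple 'I_d}|.
Local Open Scope complex_scope.
Hypotheses (k0 : (0 < k)%N) (n0 : (0 < n)%N).
Hypothesis dvd_k : forall i, (1 <= i <= m)%N -> (i %| k)%N.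

(** The coefficients of exp L on words of length k, as forms in the coordinates of L.
    They span by [coef_span_monomial]. *)
Lemma rough_veronese_system : exists G : N.-tuple {mpoly R[i][n]},
  [/\ forall j, tnth G j \is k.-homog for (wdeg w),
      forall M, wdeg w M = k -> exists b : 'I_N -> R[i], 'X_[M] = \sum_j b j *: tnth G j,
      forall L, lie_truncated m L -> exists c : 'rV[R]_n,
        tensor_component k (texp L) = system_map G (map_mx (real_complex R) c) &
      forall c : 'rV[R]_n, exists2 L, lie_truncated m L &
        tensor_component k (texp L) = system_map G (map_mx (real_complex R) c)].
Proof.
have [Q [Qp Qh Qc QL]] := lie_truncated_coordinates R d m.
have /choice[p pP] : forall t : k.-tuple 'I_d, exists p : {mpoly R[n]},
    p \is k.-homog for (wdeg w) /\ forall c, texp (lie_point Q c) t = p.@[c 0].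
  by move=> t; have := graded_texp Qh t; rewrite size_tuple.
pose G := [tuple map_mpoly (real_complex R) (p (enum_val j)) | j < N] :
  N.-tuple {mpoly R[i][n]}.
have GE j : tnth G j = map_mpoly (real_complex R) (p (enum_val j)) by rewrite tnth_mktuple.
have Gc c : tensor_component k (texp (lie_point Q c)) =
    system_map G (map_mx (real_complex R) c).
  apply/rowP => j; rewrite !mxE GE; have [_ ->] := pP (enum_val j).
  rewrite -map_mpoly_meval; apply: meval_eq => i; by rewrite mxE.
exists G; split.
- by move=> j; rewrite GE; apply: dhomog_map_mpoly; case: (pP (enum_val j)).
- move=> M wM; have := coef_span_monomial Qp Qc M; rewrite wM => -[b bE].
  have XE : 'X_[M] = \sum_(t : k.-tuple 'I_d) b t *: p t.
    apply: mpoly_eq_eval => c; rewrite mevalX bE raddf_sum /=.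
    by apply: eq_bigr => t _; rewrite mevalZ; case: (pP t) => _ ->.
  exists (fun j => real_complex R (b (enum_val j))).
  rewrite -(map_mpolyX (real_complex R)) XE raddf_sum /=.
  rewrite (reindex (@enum_val _ (mem {: k.-tuple 'I_d}))) /=; last first.
    exact/onW_bij/enum_val_bij.
  by apply: eq_bigr => j _; rewrite map_mpolyZ GE.
- by move=> L /QL[c ->]; exists c; apply: Gc.
by move=> c; exists (lie_point Q c); [apply/QL; exists c | apply: Gc].
Qed.

(** A form vanishing on the real points pulls back to a polynomial vanishing at all
    non-zero real vectors, which is 0.  So the closure of the real points is the
    whole image, which is closed. *)
Lemma rough_veronese_isomorphic_normal :
  isomorphic (rough_veronese R d k m) [set: wproj R[i] w] /\
  projectively_normal (rough_veronese R d k m).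
Proof.
have [G [Gh Gs Ge Gr]] := rough_veronese_system.
have w_bounds i : (0 < w i <= m)%N := lyndon_weight_bounds i.
have w0 i : (0 < w i)%N by case/andP: (w_bounds i).
have wk i : (w i %| k)%N := dvd_k (w_bounds i).
have pk (M : 'X_{1..n}) j : wdeg w M = (j.+1 * k)%N ->
  exists M1 M2, M = (M1 + M2)%MM /\ wdeg w M1 = k := monomial_packing w_bounds k0 dvd_k.
suff -> : rough_veronese R d k m = range (system_proj wk Gs).
  split; first exact: system_image_isomorphic.
  exact: system_image_projectively_normal.
apply/seteqP; split.
  apply: bigcap_inf; split;
    first by case: (system_proj_closed_immersion w0 wk k0 pk Gh Gs n0).
  move=> _ [L [Lm [hv ->]]]; have [c cE] := Ge L Lm.
  have c0 : map_mx (real_complex R) c != 0.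
    by apply: contraNneq hv => c0; rewrite cE c0 (system_map0 k0 Gh).
  exists (wpoint w c0) => //; rewrite system_proj_wpoint //.
  by apply/wpoint_eqP; exists 1 => [|j]; rewrite ?oner_neq0 // expr1n mul1r cE.
move=> _ [x _ <-] B [[S [hS ->]] sub] q Sq; have [D hq] := hS q Sq.
apply/(system_proj_eq0 wk Gs x hq).
suff -> : q \mPo G = 0 by rewrite meval0.
have real0 (c : 'rV[R]_n) : c != 0 -> (q \mPo G).@[map_mx (real_complex R) c 0] = 0.
  move=> c0; rewrite comp_eval; have [L Lm LE] := Gr c.
  have c0' : map_mx (real_complex R) c != 0 by rewrite map_mx_eq0.
  have hv : tensor_component k (texp L) != 0.
    by rewrite LE (system_map_neq0 wk Gs).
  rewrite -LE; apply/(dhomog_hcoord_eq0 hv hq).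
  apply: (sub (wpoint _ hv)) => //; exists L; split=> //; by exists hv.
(* a factor vanishing at the origin removes the condition c != 0 *)
pose i0 : 'I_n := Ordinal n0.
suff : (q \mPo G) * 'X_i0 = 0.
  by move/eqP; rewrite mulf_eq0 => /orP[/eqP //|]; rewrite -msupp_eq0 msuppX.
apply/eqP; apply: contraT => /mpoly_nat_nonroot[a]; rewrite mevalM mevalXU.
have [->|ai] := eqVneq (a i0) 0%N; first by rewrite mulr0 eqxx.
pose c : 'rV[R]_n := \row_i (a i)%:R.
rewrite (meval_eq (v2 := map_mx (real_complex R) c 0)); last first.
  by move=> i; rewrite !mxE rmorph_nat.
rewrite real0 ?mul0r ?eqxx //; apply/eqP => /rowP/(_ i0)/eqP.
by rewrite !mxE pnatr_eq0 (negbTE ai).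
Qed.

End RoughVeronese.

Theorem corollary2p20 (R : realType) (d k m : nat)
    (hd : (2 <= d)%N) (hk : (1 <= k)%N) (hm : (1 <= m)%N) :
  (rational_map_embedding (lyndon_weight d m) (@std_weight _)
     (@wmonomial_map R[i] _ (lyndon_weight d m) k)
   <-> (forall i : nat, (1 <= i <= m)%N -> (i %| k)%N))
  /\
  ((forall i : nat, (1 <= i <= m)%N -> (i %| k)%N) ->
   isomorphic (rough_veronese R d k m)
     (@setT (wproj R[i] (lyndon_weight d m)))
   /\ projectively_normal (rough_veronese R d k m)).
Proof.
have [x [y [xy wx wy]]] := lyndon_weight1_exists2 hd hm.
have n0 : (0 < size (lyndon_weights d m))%N by apply: leq_ltn_trans (ltn_ord x).
split; last by move=> dvd; apply: rough_veronese_isomorphic_normal.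
split=> [emb i im|dvd]; last first.
  exact: (wmonomial_map_embedding _ (@lyndon_weight_bounds d m) hk n0 dvd).
apply: contraT => ni; have [z zi] := lyndon_weight_exists hd im.
by case: (no_embedding xy wx wy _ emb (z := z)); rewrite zi.
Qed.
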